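(* Let $G$ be a finite group acting on a $\mathrm{II}_1$ factor $M$ by outer automorphisms $\alpha\colon G\to\mathrm{Aut}(M)$. Then $$\mathcal{N}(M^G)''=M^{[G,G]}.$$
   Context: $\mathrm{II}_1$ factors are assumed separable. An action by outer automorphisms is a homomorphism $\alpha\colon G\to\mathrm{Aut}(M)$ such that $\alpha_g$ is not inner for every $g\ne e$. For a subgroup $H\subseteq G$, the fixed point algebra is $M^H=\{x\in M:\alpha_h(x)=x \text{ for all } h\in H\}$. $\mathcal{N}(M^G)=\{u\in M\text{ unitary}: uM^Gu^*=M^G\}$ is the group of unitary normalizers of $M^G$ in $M$, and $\mathcal{N}(M^G)''$ is the von Neumann algebra it generates. $[G,G]$ is the commutator subgroup of $G$. *)

(* Defs.v *)
From HB Require Import structures.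
From mathcomp Require Import all_boot all_order all_algebra all_fingroup.
From mathcomp Require Import all_classical all_reals all_analysis.
From mathcomp Require Import complex.

Set Implicit Arguments.
Unset Strict Implicit.
Unset Printing Implicit Defensive.

Import Order.TTheory GRing.Theory Num.Theory.
Import numFieldNormedType.Exports.

Local Open Scope classical_set_scope.
Local Open Scope ring_scope.

(* A Hilbert space is a Banach space [H] over [R[i]] together with a
   positive-definite form [dot], linear in its first argument, that induces the
   norm of [H]. *)
Definition induces_norm (R : realType) (H : completeNormedModType R[i])
    (dot : {dot H for Num.conj}) : Prop :=
  forall v : H, `|v| ^+ 2 = dot v v.

Definition separable_space (T : topologicalType) : Prop :=
  exists2 D : set T, countable D & dense D.

(* Operators are plain functions [H -> H], so that sums and scalar multiples are
   pointwise and the product is composition. *)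
Definition bounded_operator (R : realType) (H : completeNormedModType R[i]) :
    set (H -> H) :=
  [set x | linear x /\ exists k : R[i], forall v, `|x v| <= k * `|v|].

(* [y] is the adjoint of [x]; such a [y] is unique. *)
Definition is_adjoint (R : realType) (H : completeNormedModType R[i])
    (dot : {dot H for Num.conj}) (x y : H -> H) : Prop :=
  forall v w : H, dot (x v) w = dot v (y w).

Definition commutant (R : realType) (H : completeNormedModType R[i])
    (S : set (H -> H)) : set (H -> H) :=
  [set y | bounded_operator y /\ forall x, S x -> x \o y = y \o x].

(* A double commutant consists of bounded operators and is a unital algebra, so
   these closure properties need not be required separately. *)
Definition von_neumann_algebra (R : realType) (H : completeNormedModType R[i])
    (dot : {dot H for Num.conj}) (M : set (H -> H)) : Prop :=
  (forall x, M x -> exists2 y, M y & is_adjoint dot x y) /\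
  commutant (commutant M) = M.

Definition factor (R : realType) (H : completeNormedModType R[i])
    (dot : {dot H for Num.conj}) (M : set (H -> H)) : Prop :=
  von_neumann_algebra dot M /\
  M `&` commutant M = [set x | exists c : R[i], x = c *: idfun].

Definition finite_dimensional (R : realType) (H : completeNormedModType R[i])
    (M : set (H -> H)) : Prop :=
  exists n (e : 'I_n -> H -> H), forall x, M x ->
    exists c : 'I_n -> R[i], x = \sum_i c i *: e i.

Definition self_adjoint_part (R : realType) (H : completeNormedModType R[i])
    (dot : {dot H for Num.conj}) (M : set (H -> H)) : set (H -> H) :=
  [set x | M x /\ is_adjoint dot x x].

(* On [R[i]], [0 <= z] means that [z] is real and nonnegative. *)
Definition operator_le (R : realType) (H : completeNormedModType R[i])
    (dot : {dot H for Num.conj}) (x y : H -> H) : Prop :=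
  forall v : H, 0 <= dot ((y - x) v) v.

Definition directed_set (T : Type) (le : T -> T -> Prop) (D : set T) : Prop :=
  D !=set0 /\
  forall x y, D x -> D y -> exists z, [/\ D z, le x z & le y z].

Definition least_upper_bound (T : Type) (le : T -> T -> Prop)
    (A D : set T) (a : T) : Prop :=
  [/\ A a, forall d, D d -> le d a &
      forall b, A b -> (forall d, D d -> le d b) -> le a b].

(* Normality: [tau] preserves suprema of increasing nets of self-adjoint
   elements, an increasing net being represented by its directed range. *)
Definition normal_functional (R : realType) (H : completeNormedModType R[i])
    (dot : {dot H for Num.conj}) (M : set (H -> H))
    (tau : (H -> H) -> R[i]) : Prop :=
  forall (D : set (H -> H)) (a : H -> H),
    D `<=` self_adjoint_part dot M ->
    directed_set (operator_le dot) D ->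
    least_upper_bound (operator_le dot) (self_adjoint_part dot M) D a ->
    least_upper_bound (fun s t : R[i] => s <= t) setT (tau @` D) (tau a).

Definition faithful_normal_tracial_state (R : realType)
    (H : completeNormedModType R[i]) (dot : {dot H for Num.conj})
    (M : set (H -> H)) (tau : (H -> H) -> R[i]) : Prop :=
  [/\ forall (c : R[i]) x y, M x -> M y -> tau (c *: x + y) = c * tau x + tau y,
      forall x y, M x -> is_adjoint dot x y -> 0 <= tau (y \o x),
      tau idfun = 1,
      forall x y, M x -> M y -> tau (x \o y) = tau (y \o x) &
      (forall x y, M x -> is_adjoint dot x y -> tau (y \o x) = 0 -> x = 0) /\
      normal_functional dot M tau].

Definition II1_factor (R : realType) (H : completeNormedModType R[i])
    (dot : {dot H for Num.conj}) (M : set (H -> H)) : Prop :=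
  [/\ factor dot M, ~ finite_dimensional M &
      exists tau, faithful_normal_tracial_state dot M tau].

Definition automorphism (R : realType) (H : completeNormedModType R[i])
    (dot : {dot H for Num.conj}) (M : set (H -> H))
    (theta : (H -> H) -> (H -> H)) : Prop :=
  [/\ set_bij M M theta,
      forall (c : R[i]) x y, M x -> M y ->
        theta (c *: x + y) = c *: theta x + theta y,
      forall x y, M x -> M y -> theta (x \o y) = theta x \o theta y &
      forall x y, M x -> M y -> is_adjoint dot x y ->
        is_adjoint dot (theta x) (theta y)].

Definition unitary_with_adjoint (R : realType)
    (H : completeNormedModType R[i]) (dot : {dot H for Num.conj})
    (u v : H -> H) : Prop :=
  [/\ is_adjoint dot u v, u \o v = idfun & v \o u = idfun].

Definition inner_automorphism (R : realType) (H : completeNormedModType R[i])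
    (dot : {dot H for Num.conj}) (M : set (H -> H))
    (theta : (H -> H) -> (H -> H)) : Prop :=
  exists u v, [/\ M u, unitary_with_adjoint dot u v &
                  forall x, M x -> theta x = u \o x \o v].

(* Only the values of [alpha g] on [M], for [g] in [G], are relevant. *)
Definition outer_action (R : realType) (H : completeNormedModType R[i])
    (dot : {dot H for Num.conj}) (M : set (H -> H))
    (gT : finGroupType) (G : {group gT})
    (alpha : gT -> (H -> H) -> (H -> H)) : Prop :=
  [/\ forall g, g \in G -> automorphism dot M (alpha g),
      forall g h, g \in G -> h \in G ->
        forall x, M x -> alpha (g * h)%g x = alpha g (alpha h x) &
      forall g, g \in G -> g != 1%g -> ~ inner_automorphism dot M (alpha g)].

Definition fixed_points (R : realType) (H : completeNormedModType R[i])
    (M : set (H -> H)) (gT : finGroupType)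
    (alpha : gT -> (H -> H) -> (H -> H)) (A : {set gT}) : set (H -> H) :=
  [set x | M x /\ forall h, h \in A -> alpha h x = x].

Definition unitary_normalizer (R : realType) (H : completeNormedModType R[i])
    (dot : {dot H for Num.conj}) (M N : set (H -> H)) : set (H -> H) :=
  [set u | M u /\ exists v, unitary_with_adjoint dot u v /\
                            [set u \o x \o v | x in N] = N].

(* Main.v *)
(* Put N = M^G and K = [G, G]. Algebraically, M is a simple ring, and a
   subbimodule of the direct sum of the M_g (M with right action twisted by
   alpha_g) is a sum of some of the M_g, since outerness makes these simple
   bimodules pairwise non-isomorphic. This yields a Galois basis, hence
   N' cap M = C. If u normalizes N then u^* alpha_g(u) lies in N' cap M, so
   alpha_g(u) = chi(g) u for a character chi, and u is fixed by K.

   Conversely M^K is spanned by the eigenspaces P_chi of G. A maximal partial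
   isometry v in P_chi satisfies (1 - v v^* ) P_chi (1 - v^* v) = 0; by the same
   bimodule argument and the trace, v is unitary. So P_chi = v N with v a
   normalizer, and N is spanned by its unitaries.

   Finally M^K is its own bicommutant: comparing the trace with vector
   functionals gives, for each k in K, a nonzero operator S on H with
   S alpha_k(y) = y S for all y in M. It commutes with M^K, and an x in M that
   commutes with S satisfies S r (alpha_k(x) - x) = 0 for all r in M, so
   alpha_k(x) = x because M is simple. *)

Require Import Defs.
From HB Require Import structures.
From mathcomp Require Import all_boot all_order all_algebra all_fingroup.
From mathcomp Require Import all_classical all_reals all_analysis.
From mathcomp Require Import complex ring lra.
From mathcomp Require cyclic separable cyclotomic.
From Stdlib Require Ncring Ncring_tac.

Set Implicit Arguments.
Unset Strict Implicit.
Unset Printing Implicit Defensive.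

Import Order.TTheory GRing.Theory Num.Theory.
Import numFieldNormedType.Exports.

Local Open Scope classical_set_scope.
Local Open Scope ring_scope.

(** The automorphisms are given only algebraically: strong continuity is not part of the definition,
    and no unitary on [H] implements them. What can be recovered is order. A positive element is a
    square, so automorphisms preserve positivity, hence increasing sequences in the unit interval
    together with their strong limits. This is why [monotone_closed], closure under exactly such
    limits, is the notion of subalgebra used throughout: fixed point algebras and centralizers both
    satisfy it, and it suffices for square roots, inverses and spectral projections, each built by a
    monotone iteration. Maximal projections and partial isometries come from an exhaustion in which
    the bounded trace measures progress, so countable chains suffice and nets appear only when
    normality of the given trace is unfolded. *)

Local Notation Re := complex.Re.

(** * Normalization of identities in noncommutative rings *)

Section NoncommutativeRing.
Variable A : pzRingType.

#[global] Instance pzRing_ring_ops : @Ncring.Ring_ops A 0 1 (@GRing.add A)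
  (@GRing.mul A) (fun x y => x - y) (@GRing.opp A) eq := {}.

#[global] Instance pzRing_ring : Ncring.Ring (Ro := pzRing_ring_ops).
Proof.
constructor; try (by move=> *; subst).
- exact: RelationClasses.eq_equivalence.
- by move=> a b -> c d ->.
- by move=> a b -> c d ->.
- by move=> a b -> c d ->.
- by move=> a b ->.
- exact: add0r.
- exact: addrC.
- exact: addrA.
- exact: mul1r.
- exact: mulr1.
- exact: mulrA.
- exact: mulrDl.
- by move=> x y z; exact: mulrDr.
- exact: addrN.
Qed.

End NoncommutativeRing.

Ltac ncring := Ncring_tac.non_commutative_ring.

Lemma conjc_i (R : rcfType) : ('i%C : R[i])^*%C = - 'i%C.
Proof. by apply/eqP; rewrite eq_complex /= oppr0 !eqxx. Qed.

(** * Hilbert space geometry and sequential norm convergence *)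

Section HilbertSpace.
Variables (R : realType) (H : completeNormedModType R[i]).
Variable dot : {dot H for Num.conj}.
Hypothesis hdot : induces_norm dot.
Implicit Types (u v w : H) (a : R) (c : R[i]).

(** Real values keep inequalities within reach of [lra] and [nra]; nothing is lost, since [dotE]
    recovers the complex form from real parts. *)
Definition rdot v w : R := Re (dot v w).
Definition hnorm v : R := Re `|v|.

Lemma hnormE v : (hnorm v)%:C%C = `|v|.
Proof. by rewrite /hnorm RRe_real // realE normr_ge0. Qed.

Lemma hnorm_ge0 v : 0 <= hnorm v.
Proof. by rewrite -ler0c hnormE. Qed.

Lemma hnorm_sq v : hnorm v ^+ 2 = rdot v v.
Proof. by rewrite /rdot -hdot -hnormE -rmorphXn. Qed.

Lemma rdot_ge0 v : 0 <= rdot v v.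
Proof. by rewrite -hnorm_sq sqr_ge0. Qed.

Lemma rdotC v w : rdot v w = rdot w v.
Proof. by rewrite /rdot hermC /= expr0 mul1r; case: (dot w v). Qed.

Lemma rdotDl u v w : rdot (u + v) w = rdot u w + rdot v w.
Proof. by rewrite /rdot linearDl raddfD. Qed.

Lemma rdotDr u v w : rdot w (u + v) = rdot w u + rdot w v.
Proof. by rewrite rdotC rdotDl !(rdotC w). Qed.

Lemma rdot0l v : rdot 0 v = 0.
Proof. by rewrite /rdot linear0l. Qed.

Lemma rdot0r v : rdot v 0 = 0.
Proof. by rewrite rdotC rdot0l. Qed.

Lemma rdotNl v w : rdot (- v) w = - rdot v w.
Proof. by rewrite /rdot linearNl raddfN. Qed.

Lemma rdotNr v w : rdot w (- v) = - rdot w v.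
Proof. by rewrite rdotC rdotNl rdotC. Qed.

Lemma rdotBl u v w : rdot (u - v) w = rdot u w - rdot v w.
Proof. by rewrite rdotDl rdotNl. Qed.

Lemma rdotBr u v w : rdot w (u - v) = rdot w u - rdot w v.
Proof. by rewrite rdotDr rdotNr. Qed.

Lemma rdotZl a v w : rdot (a%:C%C *: v) w = a * rdot v w.
Proof.
by rewrite /rdot linearZl_LR /=; case: (dot v w) => x y /=; rewrite mul0r subr0.
Qed.

Lemma rdotZr a v w : rdot w (a%:C%C *: v) = a * rdot w v.
Proof. by rewrite rdotC rdotZl rdotC. Qed.

Lemma rdot_conj c v w : rdot (c *: v) w = rdot v (c^*%C *: w).
Proof. by rewrite /rdot linearZl_LR linearZr_LR /= conjCK. Qed.

Lemma dotE v w : dot v w = Complex (rdot v w) (rdot v ('i%C *: w)).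
Proof.
rewrite /rdot linearZr_LR /=; case: (dot v w) => x y /=.
by rewrite !mul0r mulN1r opprK add0r.
Qed.

Lemma hnorm0 : hnorm 0 = 0.
Proof. by rewrite /hnorm normr0. Qed.

Lemma hnormN v : hnorm (- v) = hnorm v.
Proof. by rewrite /hnorm normrN. Qed.

Lemma hnormD v w : hnorm (v + w) <= hnorm v + hnorm w.
Proof. by rewrite -lecR rmorphD /= !hnormE ler_normD. Qed.

Lemma hnormZ c v : hnorm (c *: v) = Re `|c| * hnorm v.
Proof.
rewrite [LHS]/hnorm normrZ -hnormE.
by case: `|c| => x y /=; rewrite mulr0 subr0.
Qed.

Lemma hnorm_eq0 v : hnorm v = 0 -> v = 0.
Proof. by move=> v0; apply/eqP; rewrite -normr_eq0 -hnormE v0. Qed.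

Lemma hnorm_gt0 v : v != 0 -> 0 < hnorm v.
Proof. by move=> v0; rewrite -ltcR hnormE normr_gt0. Qed.

Lemma rdot_eq0 v : rdot v v = 0 -> v = 0.
Proof. by rewrite -hnorm_sq => /eqP; rewrite sqrf_eq0 => /eqP/hnorm_eq0. Qed.

Lemma rdot_ext u v : (forall w, rdot u w = rdot v w) -> u = v.
Proof.
move=> uv; apply/eqP; rewrite -subr_eq0; apply/eqP/rdot_eq0.
by rewrite rdotBl uv subrr.
Qed.

Lemma hnormD_sq v w : hnorm (v + w) ^+ 2 = hnorm v ^+ 2 + 2 * rdot v w + hnorm
  w ^+ 2.
Proof. rewrite !hnorm_sq !rdotDl !rdotDr (rdotC w v); lra. Qed.

Lemma hnormB_sq v w : hnorm (v - w) ^+ 2 = hnorm v ^+ 2 - 2 * rdot v w + hnorm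
  w ^+ 2.
Proof. by rewrite hnormD_sq rdotNr hnormN mulrN. Qed.

Lemma rdot_le v w : rdot v w <= hnorm v * hnorm w.
Proof.
have [->|v0] := eqVneq v 0.
  by rewrite hnorm0 mul0r rdot0l.
have [->|w0] := eqVneq w 0.
  by rewrite hnorm0 mulr0 rdot0r.
have a0 := hnorm_gt0 v0; have b0 := hnorm_gt0 w0.
set a := hnorm v in a0 *; set b := hnorm w in b0 *.
(* This square expands to [2ab(ab - rdot v w)]. *)
have := rdot_ge0 (b%:C%C *: v - a%:C%C *: w).
rewrite !rdotBl !rdotBr !rdotZl !rdotZr (rdotC w v) -!hnorm_sq -/a -/b => h.
have ab0 : 0 < a * b by rewrite mulr_gt0.
rewrite -(ler_pM2l ab0); nra.
Qed.

Lemma rdot_abs_le v w : `|rdot v w| <= hnorm v * hnorm w.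
Proof.
rewrite ler_norml rdot_le andbT lerNl -rdotNl.
by apply: le_trans (rdot_le _ _) _; rewrite hnormN.
Qed.

(** Phrased through a real sequence, so that limit arguments take place in [R]; the completeness of
    [H] enters only through [hcauchy]. *)
Definition hcvg (x : nat -> H) (l : H) := hnorm (x n - l) @[n --> \oo] --> (0 : R).

Lemma squeeze0 (f g : nat -> R) : (forall n, 0 <= f n <= g n) ->
  g n @[n --> \oo] --> (0 : R) -> f n @[n --> \oo] --> (0 : R).
Proof.
move=> fg g0; apply: (squeeze_cvgr _ (cvg_cst 0) g0).
by apply: nearW => n; apply: fg.
Qed.

Lemma hcvg_const v : hcvg (fun=> v) v.
Proof. rewrite /hcvg subrr hnorm0; exact: cvg_cst. Qed.

Lemma hcvgD x y v w : hcvg x v -> hcvg y w -> hcvg (fun n => x n + y n) (v + w).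
Proof.
move=> xv yw; apply: (@squeeze0 _ (fun n => hnorm (x n - v) + hnorm (y n - w))).
  by move=> n; rewrite hnorm_ge0 opprD addrACA hnormD.
rewrite -[0]addr0; exact: cvgD.
Qed.

Lemma hcvg_bounded (f : H -> H) (k : R) x v : linear f ->
  (forall u, hnorm (f u) <= k * hnorm u) -> hcvg x v -> hcvg (f \o x) (f v).
Proof.
move=> fl fk xv; apply: (@squeeze0 _ (fun n => k * hnorm (x n - v))).
  move=> n; rewrite hnorm_ge0 /=; apply: le_trans (fk _).
  by rewrite -(addrC (- v)) -[X in f (X + _)]scaleN1r fl scaleN1r addrC.
rewrite -(mulr0 k); apply: cvgM => //; exact: cvg_cst.
Qed.

Lemma hcvgZ c x v : hcvg x v -> hcvg (fun n => c *: x n) (c *: v).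
Proof.
apply: (@hcvg_bounded ( *:%R c) (Re `|c|)) => [a u w|u]; last by rewrite hnormZ.
by rewrite scalerDr !scalerA mulrC.
Qed.

Lemma hcvgN x v : hcvg x v -> hcvg (fun n => - x n) (- v).
Proof.
by move=> /(hcvgZ (-1)); rewrite scaleN1r; under eq_fun do rewrite scaleN1r.
Qed.

Lemma hcvgB x y v w : hcvg x v -> hcvg y w -> hcvg (fun n => x n - y n) (v - w).
Proof. by move=> xv /hcvgN; apply: hcvgD. Qed.

Lemma hcvg_unique x v w : hcvg x v -> hcvg x w -> v = w.
Proof.
move=> xv xw; have := hcvgB xv xw.
under eq_fun do rewrite subrr.
rewrite /hcvg; under eq_fun do rewrite sub0r hnormN.
move=> /(cvg_unique _ (cvg_cst _)) => /(_ (@Rhausdorff R)) h.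
by apply/eqP; rewrite -subr_eq0; apply/eqP/hnorm_eq0.
Qed.

Lemma hcvg_rdot x v w : hcvg x v -> rdot (x n) w @[n --> \oo] --> rdot v w.
Proof.
move=> xv; apply/cvgrPdist_lt => e e0.
have : hnorm (x n - v) * hnorm w @[n --> \oo] --> (0 : R).
  rewrite -(mul0r (hnorm w)); apply: cvgM => //; exact: cvg_cst.
move=> /cvgrPdist_lt/(_ e e0); apply: filterS => n.
rewrite sub0r normrN ger0_norm ?mulr_ge0 ?hnorm_ge0 // -rdotBl => h.
by apply: le_lt_trans h; rewrite -opprB rdotNl normrN rdot_abs_le.
Qed.

Lemma hcvg_hnorm x v : hcvg x v -> hnorm (x n) @[n --> \oo] --> hnorm v.
Proof.
move=> xv; apply/cvgrPdist_lt => e e0.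
move: xv => /cvgrPdist_lt/(_ e e0); apply: filterS => n.
rewrite sub0r normrN ger0_norm ?hnorm_ge0 // => h.
apply: le_lt_trans h; rewrite ler_norml.
have h1 := hnormD (v - x n) (x n); have h2 := hnormD (x n - v) v.
rewrite subrK in h1; rewrite subrK in h2.
rewrite -(opprB (x n)) hnormN in h1; apply/andP; split; lra.
Qed.

Lemma hcvg_shift x v : hcvg x v -> hcvg (fun n => x n.+1) v.
Proof. by move=> xv; rewrite /hcvg (cvg_shiftS (fun n => hnorm (x n - v))). Qed.

Lemma hcauchy (x : nat -> H) :
  (forall e, 0 < e -> exists N, forall m n, (N <= m)%N -> (N <= n)%N ->
     hnorm (x m - x n) < e) ->
  exists v, hcvg x v.
Proof.
move=> xC; have cx : cauchy (x @ \oo).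
  apply/cauchy_ballP => e e0.
  have er : (Re e)%:C%C = e by rewrite RRe_real // realE ltW.
  have [N hN] := xC (Re e) (etrans (esym (ltcR 0 (Re e))) (etrans (f_equal _
    er) e0)).
  near=> p; rewrite -ball_normE /=.
  suff [[m hm pm] [n hn pn]] : (exists2 m,
    (N <= m)%N & p.1 = x m) /\ (exists2 n, (N <= n)%N & p.2 = x n).
    by rewrite pm pn -hnormE -er ltcR hN.
  split.
    near: p; exists ([set x m | m in [set m | (N <= m)%N]], setT) => /=.
      split; last exact: filterT.
      by exists N => // m /= hm; exists m.
    by move=> [a b] /= [[m hm <-] _]; exists m.
  near: p; exists (setT, [set x m | m in [set m | (N <= m)%N]]) => /=.
    split; first exact: filterT.
    by exists N => // m /= hm; exists m.
  by move=> [a b] /= [_ [m hm <-]]; exists m.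
have /cvg_ex[v xv] : cvg (x @ \oo) by apply: cauchy_cvg.
exists v; apply/cvgrPdist_lt => e e0.
have e0' : 0 < e%:C%C :> R[i] by rewrite ltcR.
move/cvgrPdist_lt : xv => /(_ _ e0'); apply: filterS => n.
rewrite sub0r normrN ger0_norm ?hnorm_ge0 // -opprB normrN -hnormE.
by rewrite ltcR.
Unshelve. all: by end_near.
Qed.

End HilbertSpace.

(** * The operators of [M] as a complex algebra with involution *)

Section OperatorAlgebra.
Variables (R : realType) (H : completeNormedModType R[i]).
Variable dot : {dot H for Num.conj}.

Lemma bounded_operatorP (f : H -> H) : bounded_operator f <->
  linear f /\ exists2 k : R, 0 <= k & forall v, hnorm (f v) <= k * hnorm v.
Proof.
split=> [[fl [k hk]]|[fl [k k0 hk]]]; split=> //.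
  exists `|Re k| => // v; have := hk v.
  rewrite -!hnormE lecE => /andP[_] h.
  have {h} : hnorm (f v) <= Re k * hnorm v.
    by move: h; case: (k) => a b /=; rewrite mulr0 subr0.
  by move=> h; apply: (le_trans h); rewrite ler_wpM2r ?hnorm_ge0 ?ler_norm.
by exists k%:C%C => v; rewrite -!hnormE -rmorphM lecR.
Qed.

(** What is retained of the bicommutant condition. Strong closure is sequential, with boundedness of
    the limit left to the caller. *)
Record star_algebra (M : set (H -> H)) : Prop := StarAlgebra {
  star_algebra_form : induces_norm dot;
  star_algebra_bounded : M `<=` bounded_operator (H := H);
  star_algebra_id : M idfun;
  star_algebra_neq0 : (idfun : H -> H) <> 0;
  star_algebra_lin : forall c x y, M x -> M y -> M (c *: x + y);
  star_algebra_comp : forall x y, M x -> M y -> M (x \o y);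
  star_algebra_adj : forall x, M x -> exists2 y, M y & is_adjoint dot x y;
  star_algebra_lim : forall (x : nat -> H -> H) y, (forall n, M (x n)) ->
    bounded_operator y -> (forall v, hcvg (x^~ v) (y v)) -> M y }.

(** A wrapper is needed because the product is composition; indexing the type by [hM] lets the
    algebra structures be inferred from the type. *)
Record opalg (M : set (H -> H)) (hM : star_algebra M) : Type :=
  OpAlg { opval :> H -> H; opvalP : M opval }.

Variables (M : set (H -> H)) (hM : star_algebra M).
Local Notation A := (opalg hM).
Implicit Types (x y z : A) (v w : H) (c : R[i]).

Let hdot := star_algebra_form hM.

HB.instance Definition _ := gen_eqMixin A.
HB.instance Definition _ := gen_choiceMixin A.

Lemma op_inj x y : (opval x = opval y) -> x = y.
Proof.
by case: x y => [x px] [y py] /= e; subst; congr OpAlg; apply: Prop_irrelevance.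
Qed.

Lemma opP x y : (forall v, x v = y v) -> x = y.
Proof. by move=> h; apply/op_inj/funext. Qed.

Lemma op_linear x : linear x.
Proof. by case: (star_algebra_bounded hM (opvalP x)). Qed.

Lemma op_scaleD x c v w : x (c *: v + w) = c *: x v + x w.
Proof. exact: op_linear. Qed.

Lemma opD x v w : x (v + w) = x v + x w.
Proof. by rewrite -[v]scale1r op_scaleD !scale1r. Qed.

Lemma op0 x : x 0 = 0.
Proof. by apply: (addIr (x 0)); rewrite -opD !add0r. Qed.

Lemma opZ x c v : x (c *: v) = c *: x v.
Proof. by rewrite -[c *: v]addr0 op_scaleD op0 addr0. Qed.

Lemma opN x v : x (- v) = - x v.
Proof. by rewrite -scaleN1r opZ scaleN1r. Qed.

Lemma opB x v w : x (v - w) = x v - x w.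
Proof. by rewrite opD opN. Qed.

Lemma star_algebra0 : M 0.
Proof.
have := star_algebra_lin hM (-1) (star_algebra_id hM) (star_algebra_id hM).
by rewrite scaleN1r addNr.
Qed.

Lemma star_algebraZ c f : M f -> M (c *: f).
Proof.
by move=> Mf; have := star_algebra_lin hM c Mf star_algebra0; rewrite addr0.
Qed.

Lemma star_algebraD f g : M f -> M g -> M (f + g).
Proof.
by move=> Mf Mg; have := star_algebra_lin hM 1 Mf Mg; rewrite scale1r.
Qed.

Definition op_zero : A := OpAlg hM star_algebra0.
Definition op_one : A := OpAlg hM (star_algebra_id hM).
Definition op_add x y : A := OpAlg hM (star_algebraD (opvalP x) (opvalP y)).
Definition op_scale c x : A := OpAlg hM (star_algebraZ c (opvalP x)).
Definition op_opp x : A := op_scale (-1) x.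
Definition op_mul x y : A := OpAlg hM (star_algebra_comp hM (opvalP x) (opvalP y)).

Fact op_addA : associative op_add.
Proof. by move=> x y z; apply: opP => v /=; rewrite !fctE addrA. Qed.
Fact op_addC : commutative op_add.
Proof. by move=> x y; apply: opP => v /=; rewrite !fctE addrC. Qed.
Fact op_add0 : left_id op_zero op_add.
Proof. by move=> x; apply: opP => v /=; rewrite fctE add0r. Qed.
Fact op_addN : left_inverse op_zero op_opp op_add.
Proof.
by move=> x; apply: opP => v /=; rewrite fctE scaleN1r addNr.
Qed.

HB.instance Definition _ :=
  GRing.isZmodule.Build A op_addA op_addC op_add0 op_addN.

Lemma opaddE x y v : (x + y) v = x v + y v. Proof. by []. Qed.
Lemma opzeroE v : (0 : A) v = 0. Proof. by []. Qed.
Lemma opoppE x v : (- x) v = - x v.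
Proof. by rewrite -scaleN1r. Qed.

Fact op_mulA : associative op_mul. Proof. by move=> x y z; apply: opP. Qed.
Fact op_mul1l : left_id op_one op_mul. Proof. by move=> x; apply: opP. Qed.
Fact op_mul1r : right_id op_one op_mul. Proof. by move=> x; apply: opP. Qed.
Fact op_mulDl : left_distributive op_mul +%R.
Proof. by move=> x y z; apply: opP. Qed.
Fact op_mulDr : right_distributive op_mul +%R.
Proof. by move=> x y z; apply: opP => v; apply: opD. Qed.
Fact op_one_neq0 : op_one != 0.
Proof.
apply/eqP => /(congr1 (@opval _ _)) /=; exact: (star_algebra_neq0 hM).
Qed.

HB.instance Definition _ := GRing.Zmodule_isNzRing.Build A
  op_mulA op_mul1l op_mul1r op_mulDl op_mulDr op_one_neq0.

Fact op_scaleA c d x : op_scale c (op_scale d x) = op_scale (c * d) x.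
Proof. by apply: opP => v; apply: scalerA. Qed.
Fact op_scale1 : left_id 1 op_scale.
Proof. by move=> x; apply: opP => v; apply: scale1r. Qed.
Fact op_scaleDr : right_distributive op_scale +%R.
Proof. by move=> c x y; apply: opP => v; apply: scalerDr. Qed.
Fact op_scaleDl x : {morph op_scale^~ x : a b / a + b}.
Proof. by move=> c d; apply: opP => v; apply: scalerDl. Qed.

HB.instance Definition _ := GRing.Zmodule_isLmodule.Build R[i] A
  op_scaleA op_scale1 op_scaleDr op_scaleDl.

Fact op_scaleAl c x y : c *: (x * y) = (c *: x) * y.
Proof. by apply: opP. Qed.

HB.instance Definition _ := GRing.Lmodule_isLalgebra.Build R[i] A op_scaleAl.

Fact op_scaleAr c x y : c *: (x * y) = x * (c *: y).
Proof. by apply: opP => v; rewrite [RHS]opZ. Qed.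

HB.instance Definition _ := GRing.Lalgebra_isAlgebra.Build R[i] A op_scaleAr.

Lemma opscaleE c x v : (c *: x) v = c *: x v. Proof. by []. Qed.
Lemma opmulE x y v : (x * y) v = x (y v). Proof. by []. Qed.
Lemma oponeE v : (1 : A) v = v. Proof. by []. Qed.
Definition opE := (opaddE, opzeroE, opoppE, opscaleE, opmulE, oponeE).

Fact star_subproof x : exists y : A, is_adjoint dot x y.
Proof.
by have [f Mf fx] := star_algebra_adj hM (opvalP x); exists (OpAlg hM Mf).
Qed.

Definition star x : A := projT1 (cid (star_subproof x)).

Lemma starP x : is_adjoint dot x (star x).
Proof. by rewrite /star; case: cid. Qed.

Local Notation rd := (rdot dot).

Lemma rdot_star x v w : rd (x v) w = rd v (star x w).
Proof. by rewrite /rdot starP. Qed.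

Lemma star_unique x y : (forall v w, rd (x v) w = rd v (y w)) -> star x = y.
Proof.
move=> h; apply: opP => w; apply: (rdot_ext hdot) => v.
by rewrite rdotC -rdot_star h rdotC.
Qed.

Lemma star_adjoint x y : is_adjoint dot x y -> star x = y.
Proof. by move=> h; apply: star_unique => v w; rewrite /rdot h. Qed.

Lemma adjoint_star x (f : H -> H) : is_adjoint dot x f -> f = star x.
Proof.
move=> h; apply/funext => w; apply: (rdot_ext hdot) => v.
by rewrite rdotC /rdot -h starP -/(rdot _ _ _) rdotC.
Qed.

Lemma starK : involutive star.
Proof.
by move=> x; apply: star_unique => v w; rewrite rdotC -rdot_star rdotC.
Qed.

Lemma starM x y : star (x * y) = star y * star x.
Proof. by apply: star_unique => v w; rewrite !opE !rdot_star. Qed.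

Lemma starD x y : star (x + y) = star x + star y.
Proof. by apply: star_unique => v w; rewrite !opE rdotDl rdotDr !rdot_star. Qed.

Lemma starZ c x : star (c *: x) = c^*%C *: star x.
Proof. by apply: star_unique => v w; rewrite !opE rdot_conj rdot_star opZ. Qed.

Lemma star0 : star 0 = 0.
Proof. by apply: star_unique => v w; rewrite !opE rdot0l rdot0r. Qed.

Lemma star1 : star 1 = 1.
Proof. by apply: star_unique. Qed.

Lemma starN x : star (- x) = - star x.
Proof. by apply/eqP; rewrite -addr_eq0 -starD addNr star0. Qed.

Lemma starB x y : star (x - y) = star x - star y.
Proof. by rewrite starD starN. Qed.

Lemma starX x n : star (x ^+ n) = star x ^+ n.
Proof. by elim: n => [|n IH]; rewrite ?expr0 ?star1 // exprS starM IH -exprSr. Qed.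

Lemma op_bounded x : exists2 k : R, 0 <= k & forall v, hnorm (x v) <= k * hnorm v.
Proof.
by case: ((bounded_operatorP x).1 (star_algebra_bounded hM (opvalP x))).
Qed.

Lemma hcvg_op x (u : nat -> H) v : hcvg u v -> hcvg (fun n => x (u n)) (x v).
Proof.
have [k _ hk] := op_bounded x; apply: (hcvg_bounded _ hk); exact: op_linear.
Qed.

End OperatorAlgebra.

(** * Positive operators and strong limits of monotone sequences *)

Section Positivity.
Variables (R : realType) (H : completeNormedModType R[i]).
Variable dot : {dot H for Num.conj}.
Variables (M : set (H -> H)) (hM : star_algebra dot M).
Local Notation A := (opalg hM).
Local Notation rd := (rdot dot).
Local Notation "a *r x" := (a%:C%C *: x) (at level 40).
Implicit Types (x y z : A) (v w : H) (a k : R).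

Let hdot := star_algebra_form hM.

(** Self-adjointness is a separate clause because [rd] sees only the real part of the quadratic
    form. *)
Definition pos x := star x = x /\ forall v, 0 <= rd (x v) v.
Definition unit_itv x := pos x /\ pos (1 - x).

Lemma star_rZ a x : star (a *r x) = a *r star x.
Proof. by rewrite starZ conjc_real. Qed.

Lemma pos0 : pos 0.
Proof. by split; rewrite ?star0 // => v; rewrite opE rdot0l. Qed.

Lemma posD x y : pos x -> pos y -> pos (x + y).
Proof.
move=> [sx px] [sy py]; split; first by rewrite starD sx sy.
by move=> v; rewrite opE rdotDl addr_ge0.
Qed.

Lemma posZ a x : 0 <= a -> pos x -> pos (a *r x).
Proof.
move=> a0 [sx px]; split; first by rewrite star_rZ sx.
by move=> v; rewrite opE rdotZl mulr_ge0.
Qed.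

Lemma pos_conj x z : pos x -> pos (star z * x * z).
Proof.
move=> [sx px]; split; first by rewrite !starM starK sx mulrA.
by move=> v; rewrite !opE rdotC -(starK z) -rdot_star starK rdotC.
Qed.

Lemma pos1 : pos 1.
Proof. by split; rewrite ?star1 // => v; rewrite opE rdot_ge0. Qed.

Lemma pos_starM z : pos (star z * z).
Proof. by rewrite -[star z]mulr1; apply/pos_conj/pos1. Qed.

Lemma pos_conj_sa x z : star z = z -> pos x -> pos (z * x * z).
Proof. by move=> {1}<-; apply: pos_conj. Qed.

Lemma pos_sq z : star z = z -> pos (z * z).
Proof. by move=> {1}<-; apply: pos_starM. Qed.

Lemma pos_quad0 x : star x = x -> (forall v, rd (x v) v = 0) -> x = 0.
Proof.
move=> sx q0; apply: opP => v; apply: (rdot_eq0 hdot).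
(* Polarization: both cross terms equal the squared norm of [x v]. *)
have := q0 (v + x v); rewrite opD !rdotDl !rdotDr !q0 !addr0 add0r.
rewrite [X in _ + X](_ : _ = rd (x v) (x v)); last by rewrite rdot_star sx.
by move=> h; lra.
Qed.

Lemma pos_antisym x : pos x -> pos (- x) -> x = 0.
Proof.
move=> [sx px] [_ nx]; apply: pos_quad0 => // v; apply/eqP.
by rewrite eq_le px andbT -oppr_ge0 -rdotNl -opoppE nx.
Qed.

Lemma starM_eq0 x : star x * x = 0 -> x = 0.
Proof.
move=> h; apply: opP => v; apply: (rdot_eq0 hdot).
by rewrite rdot_star -opmulE h opE rdot0r.
Qed.

Lemma rdot_starM x v : rd ((star x * x) v) v = hnorm (x v) ^+ 2.
Proof. by rewrite opE (hnorm_sq hdot) rdotC -(starK x) -rdot_star starK. Qed.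

Lemma op_quad_bounded x : exists2 k, 0 < k & forall v,
  `|rd (x v) v| <= k * hnorm v ^+ 2.
Proof.
have [k k0 hk] := op_bounded x; exists (k + 1); first lra.
move=> v; apply: le_trans (rdot_abs_le hdot _ _) _; have := hk v.
have := hnorm_ge0 v; set a := hnorm v; set b := hnorm _ => a0 b0; nra.
Qed.

Lemma sa_le x : star x = x -> exists2 k,
  0 < k & pos (k *r 1 - x) /\ pos (k *r 1 + x).
Proof.
move=> sx; have [k k0 hk] := op_quad_bounded x; exists k => //.
split; split.
- by rewrite starB star_rZ star1 sx.
- move=> v; have := hk v; rewrite ler_norml !opE rdotBl rdotZl -(hnorm_sq hdot).
  by move=> /andP[_]; rewrite subr_ge0.
- by rewrite starD star_rZ star1 sx.
- move=> v; have := hk v; rewrite ler_norml !opE rdotDl rdotZl -(hnorm_sq hdot).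
  by move=> /andP[h _]; lra.
Qed.

Lemma pos_unit_itv x : pos x -> exists2 k, 0 < k & unit_itv (k *r x).
Proof.
move=> px; have [k k0 [hk _]] := sa_le px.1; exists k^-1; first by rewrite invr_gt0.
split; first by apply: posZ => //; rewrite invr_ge0 ltW.
have -> : 1 - k^-1 *r x = k^-1 *r (k *r 1 - x).
  by rewrite scalerBr scalerA -rmorphM mulVf ?gt_eqF // rmorph1 scale1r.
by apply: posZ => //; rewrite invr_ge0 ltW.
Qed.

(** Writing the product [x (1 - x)] as a sum of two conjugates gives its positivity before square
    roots are available. *)
Lemma unit_itv_sq x : unit_itv x -> pos (x - x * x).
Proof.
move=> [px qx].
have -> : x - x * x = x * (1 - x) * x + (1 - x) * x * (1 - x) by ncring.
apply: posD; first exact: pos_conj_sa px.1 qx.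
by apply: pos_conj_sa qx.1 px.
Qed.

Lemma unit_itv_hnorm x v : unit_itv x -> hnorm (x v) ^+ 2 <= rd (x v) v.
Proof.
move=> ux; have [_ /(_ v)] := unit_itv_sq ux.
by rewrite opaddE rdotDl opoppE rdotNl -{2}ux.1.1 rdot_starM subr_ge0.
Qed.

Lemma unit_itv_contr x v : unit_itv x -> hnorm (x v) <= hnorm v.
Proof.
move=> ux; have h := unit_itv_hnorm v ux.
have [_ /(_ v)] := ux.2; rewrite !opE rdotBl -(hnorm_sq hdot) subr_ge0 => h2.
by rewrite -(ler_pXn2r (ltn0Sn 1)) ?nnegrE ?hnorm_ge0 ?(le_trans h).
Qed.

Lemma unit_itv0 : unit_itv 0.
Proof. by split; [exact: pos0|rewrite subr0; exact: pos1]. Qed.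

Lemma unit_itvC x : unit_itv x -> unit_itv (1 - x).
Proof. by case=> px qx; split=> //; rewrite opprB addrC subrK. Qed.

Definition scvg (x : nat -> A) (l : A) := forall v, hcvg (fun n => x n v) (l v).

Lemma scvg_unique (x : nat -> A) l m : scvg x l -> scvg x m -> l = m.
Proof. by move=> xl xm; apply: opP => v; apply: hcvg_unique (xl v) (xm v). Qed.

Lemma scvg_const x : scvg (fun=> x) x.
Proof. by move=> v; apply: hcvg_const. Qed.

Lemma scvgD (x y : nat -> A) l m : scvg x l -> scvg y m -> scvg (fun n =>
  x n + y n) (l + m).
Proof. by move=> xl ym v; apply: hcvgD (xl v) (ym v). Qed.

Lemma scvgZ c (x : nat -> A) l : scvg x l -> scvg (fun n => c *: x n) (c *: l).
Proof. by move=> xl v; apply: hcvgZ (xl v). Qed.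

Lemma scvgN (x : nat -> A) l : scvg x l -> scvg (fun n => - x n) (- l).
Proof. by move=> /(scvgZ (-1)). Qed.

Lemma scvgB (x y : nat -> A) l m : scvg x l -> scvg y m -> scvg (fun n =>
  x n - y n) (l - m).
Proof. by move=> xl /scvgN; apply: scvgD. Qed.

Lemma scvgMl z (x : nat -> A) l : scvg x l -> scvg (fun n => z * x n) (z * l).
Proof. by move=> xl v; apply: hcvg_op (xl v). Qed.

Lemma scvgMr z (x : nat -> A) l : scvg x l -> scvg (fun n => x n * z) (l * z).
Proof. by move=> xl v; apply: xl. Qed.

Lemma scvg_shift (x : nat -> A) l : scvg x l -> scvg (fun n => x n.+1) l.
Proof. by move=> xl v; apply: hcvg_shift (xl v). Qed.

(** Multiplication is not jointly strongly continuous; the uniform contraction bound is what lets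
    the squares converge. *)
Lemma scvg_sq (x : nat -> A) l : (forall n, unit_itv (x n)) -> scvg x l ->
  scvg (fun n => x n * x n) (l * l).
Proof.
move=> ux xl v.
have h : hcvg (fun n => x n (x n v - l v) + x n (l v)) (0 + l (l v)).
  apply: hcvgD; last exact: xl.
  apply: (@squeeze0 _ _ (fun n => hnorm (x n v - l v))); last exact: xl.
  by move=> n; rewrite hnorm_ge0 subr0 unit_itv_contr.
rewrite add0r in h; congr (hcvg _ _) : h; apply/funext => n.
by rewrite -opD subrK.
Qed.

Lemma scvg_pos (x : nat -> A) l : (forall n, pos (x n)) -> scvg x l -> pos l.
Proof.
move=> px xl; split.
  apply: star_unique => v w; apply: (@cvg_unique _ _ (rd (x n v) w @[n --> \oo])).
  - exact: Rhausdorff.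
  - exact: hcvg_rdot (xl v).
  - have -> : (fun n => rd (x n v) w) = (fun n => rd (x n w) v).
      by apply/funext => n; rewrite rdot_star (px n).1 rdotC.
    by rewrite rdotC; apply: hcvg_rdot (xl w).
move=> v; have := @hcvg_rdot _ _ _ hdot _ _ v (xl v).
by move=> /cvgr_to_ge; apply; apply: nearW => n; apply: (px n).2.
Qed.

Definition monotone_unit (x : nat -> A) :=
  (forall n, unit_itv (x n)) /\ forall n, pos (x n.+1 - x n).

Lemma monotone_unit_le (x : nat -> A) m n : monotone_unit x -> (m <= n)%N ->
  pos (x n - x m).
Proof.
move=> [_ hx] /subnK <-; elim: (n - m)%N => [|j IH].
  by rewrite add0n subrr; exact: pos0.
have -> : x (j.+1 + m)%N - x m = (x (j + m).+1 - x (j + m)%N) + (x (j + m)%N - x m).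
  by rewrite addSn addrA subrK.
exact: posD.
Qed.

Lemma scvg_ge (x : nat -> A) l m : monotone_unit x -> scvg x l -> pos (l - x m).
Proof.
move=> ux xl; apply: (@scvg_pos (fun n => x (n + m)%N - x m)).
  by move=> n; apply: monotone_unit_le; rewrite ?leq_addl.
apply: scvgB; last exact: scvg_const.
move=> v; rewrite /hcvg.
by rewrite (cvg_shiftn m (fun n => hnorm (x n v - l v))); apply: xl.
Qed.

Lemma scvg_le (x : nat -> A) l z : (forall n,
  pos (z - x n)) -> scvg x l -> pos (z - l).
Proof.
move=> zx xl; apply: (scvg_pos zx); apply: scvgB => //; exact: scvg_const.
Qed.

Lemma scvg_unit_itv (x : nat -> A) l : monotone_unit x -> scvg x l -> unit_itv l.
Proof.
move=> [ux _] xl; split; first by apply: scvg_pos xl => n; case: (ux n).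
by apply: (@scvg_le x) => // n; case: (ux n).
Qed.

Lemma scvg_exists (x : nat -> A) :
  (forall n v, hnorm (x n v) <= hnorm v) ->
  (forall v, exists u, hcvg (fun n => x n v) u) -> exists l, scvg x l.
Proof.
move=> xc lim; have [f fP] := choice lim.
have fl : linear f.
  move=> c u w; apply: hcvg_unique (fP _) _.
  have := hcvgD (hcvgZ c (fP u)) (fP w).
  by congr hcvg; apply/funext => n; rewrite op_scaleD.
have Mf : M f.
  apply: (star_algebra_lim hM (x := fun n => opval (x n))) => //.
    by move=> n; apply: opvalP.
  apply/bounded_operatorP; split=> //; exists 1 => // v; rewrite mul1r.
  have := hcvg_hnorm (fP v).
  by move=> /cvgr_to_le; apply; apply: nearW => n; apply: xc.
by exists (OpAlg hM Mf) => v; apply: fP.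
Qed.

(** Vigier's theorem for sequences. The numbers [rd (x n v) v] increase and are bounded; as
    [x n - x m] lies in the unit interval, their increments dominate the squared norms of
    [x n v - x m v]. *)
Lemma monotone_scvg (x : nat -> A) : monotone_unit x -> exists l, scvg x l.
Proof.
move=> mx; have [ux hx] := mx.
have lim v : exists u, hcvg (fun n => x n v) u.
  apply: hcauchy => e e0.
  pose q n := rd (x n v) v.
  have dq m n : (m <= n)%N -> hnorm (x n v - x m v) ^+ 2 <= q n - q m.
    move=> mn; have uu : unit_itv (x n - x m).
      split; first exact: monotone_unit_le.
      rewrite opprB addrA addrAC; apply: posD; [exact: (ux n).2|exact: (ux m).1].
    by have := unit_itv_hnorm v uu; rewrite !opE /q -rdotBl.
  have qnd : nondecreasing_seq q.
    by move=> m n mn; rewrite -subr_ge0 (le_trans _ (dq _ _ mn)) ?sqr_ge0.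
  have qub : has_ubound (range q).
    exists (rd v v) => _ [n _ <-]; have [_ /(_ v)] := (ux n).2.
    by rewrite !opE rdotBl subr_ge0.
  have /cvgrPdist_lt/(_ (e ^+ 2 / 2)) := nondecreasing_cvgn qnd qub.
  case; first by rewrite divr_gt0 ?exprn_gt0.
  set s := sup _ => N _ hN; exists N.
  have key m n : (N <= m)%N -> (m <= n)%N -> hnorm (x n v - x m v) < e.
    move=> Nm mn; rewrite -(ltr_pXn2r (ltn0Sn 1)) ?nnegrE ?hnorm_ge0 1?ltW //.
    apply: le_lt_trans (dq _ _ mn) _.
    have := hN m Nm; have := hN n (leq_trans Nm mn).
    by rewrite /= !ltr_norml => /andP[? ?] /andP[? ?]; lra.
  move=> m n Nm Nn; have [mn|/ltnW nm] := leqP m n; last exact: key.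
  by rewrite -opprB hnormN key.
apply: scvg_exists lim => n v; exact: unit_itv_contr.
Qed.

End Positivity.

(** * Square roots, inverses and spectral projections in monotone closed subalgebras *)

Section MonotoneClosed.
Variables (R : realType) (H : completeNormedModType R[i]).
Variable dot : {dot H for Num.conj}.
Variables (M : set (H -> H)) (hM : star_algebra dot M).
Local Notation A := (opalg hM).
Local Notation rd := (rdot dot).
Local Notation "a *r x" := (a%:C%C *: x) (at level 40).
Implicit Types (x y z a b : A) (v w : H) (k : R) (B S : set A).

Let hdot := star_algebra_form hM.

Record monotone_closed B : Prop := MonotoneClosed {
  mclosed1 : B 1;
  mclosed_lin : forall c x y, B x -> B y -> B (c *: x + y);
  mclosedM : forall x y, B x -> B y -> B (x * y);
  mclosed_star : forall x, B x -> B (star x);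
  mclosed_lim : forall (x : nat -> A) l,
    (forall n, B (x n)) -> monotone_unit x -> scvg x l -> B l }.

Lemma mclosed0 B : monotone_closed B -> B 0.
Proof.
move=> hB; have := mclosed_lin hB (-1) (mclosed1 hB) (mclosed1 hB).
by rewrite scaleN1r addNr.
Qed.

Lemma mclosedZ B c x : monotone_closed B -> B x -> B (c *: x).
Proof. by move=> hB Bx; rewrite -[_ *: _]addr0; apply: mclosed_lin => //;
  exact: mclosed0. Qed.

Lemma mclosedD B x y : monotone_closed B -> B x -> B y -> B (x + y).
Proof. by move=> hB Bx By; rewrite -[x]scale1r; apply: mclosed_lin. Qed.

Lemma mclosedB B x y : monotone_closed B -> B x -> B y -> B (x - y).
Proof.
move=> hB Bx By; rewrite -scaleN1r; apply: mclosedD => //; exact: mclosedZ.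
Qed.

Lemma mclosedX B x n : monotone_closed B -> B x -> B (x ^+ n).
Proof.
move=> hB Bx; elim: n => [|n IH]; first by rewrite expr0; apply: mclosed1.
by rewrite exprS; apply: mclosedM.
Qed.

Lemma mclosedT : monotone_closed setT.
Proof. by []. Qed.

Lemma mclosedI B B' : monotone_closed B -> monotone_closed B' ->
  monotone_closed (B `&` B').
Proof.
move=> [h1 h2 h3 h4 h5] [g1 g2 g3 g4 g5]; split=> //.
- by move=> c x y [? ?] [? ?]; split; [apply: h2|apply: g2].
- by move=> x y [? ?] [? ?]; split; [apply: h3|apply: g3].
- by move=> x [? ?]; split; [apply: h4|apply: g4].
- move=> x l hx mx xl; split; [apply: (h5 x)|apply: (g5 x)] => // n;
  by case: (hx n).
Qed.

Definition centralizer S : set A := [set x | forall y, S y -> x * y = y * x].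

Lemma mclosed_centralizer S : (forall y, S y -> S (star y)) ->
  monotone_closed (centralizer S).
Proof.
move=> sS; split.
- by move=> y _; rewrite mul1r mulr1.
- move=> c x y hx hy z Sz.
  by rewrite mulrDl mulrDr -scalerAl -scalerAr hx // hy.
- by move=> x y hx hy z Sz; rewrite -mulrA hy // mulrA hx // mulrA.
- move=> x hx y Sy; rewrite -[y]starK -!starM hx //; exact: sS.
- move=> x l hx _ xl y Sy; apply: (@scvg_unique _ _ _ _ _ (fun n => x n * y)).
    exact: scvgMr.
  rewrite [X in scvg X](_ : _ = (fun n => y * x n)); first exact: scvgMl.
  by apply/funext => n; apply: hx.
Qed.

(** A commutative algebra containing [a]. Intersecting a subalgebra with it makes all elements built
    from [a] commute with each other and with whatever commutes with [a]. *)
Definition bicentralizer a := centralizer (centralizer [set a]).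

Lemma bicentralizer_id a : bicentralizer a a.
Proof. by move=> y /(_ a erefl). Qed.

Lemma bicentralizer_comm a x y : bicentralizer a x -> bicentralizer a y -> x *
  y = y * x.
Proof. by move=> hx hy; apply: hx => z ->; rewrite hy // => w ->. Qed.

Lemma mclosed_bicentralizer a : star a = a -> monotone_closed (bicentralizer a).
Proof.
move=> sa; apply: mclosed_centralizer => y hy z /= ->.
by rewrite -{1}sa -starM -hy // starM sa.
Qed.

(** Polynomials in [b] with nonnegative coefficients. Membership certifies positivity of products
    without [posM_comm], which itself rests on square roots. *)
Inductive cone b : A -> Prop :=
| cone_nil : cone b 0
| cone_cons k n x : 0 <= k -> cone b x -> cone b (k *r b ^+ n + x).

Lemma coneD b x y : cone b x -> cone b y -> cone b (x + y).
Proof.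
move=> cx cy; elim: cx => [|k n z k0 _ IH]; first by rewrite add0r.
by rewrite -addrA; apply: cone_cons.
Qed.

Lemma coneZ b k x : 0 <= k -> cone b x -> cone b (k *r x).
Proof.
move=> k0; elim=> [|j n z j0 _ IH]; first by rewrite scaler0; apply: cone_nil.
by rewrite scalerDr scalerA -rmorphM; apply: cone_cons => //; rewrite mulr_ge0.
Qed.

Lemma coneM b x y : cone b x -> cone b y -> cone b (x * y).
Proof.
move=> cx cy; elim: cx => [|k n z k0 _ IH]; first by rewrite mul0r; apply: cone_nil.
rewrite mulrDl -scalerAl; apply: coneD => //; apply: coneZ => //.
elim: cy => [|j m w j0 _ IHw]; first by rewrite mulr0; apply: cone_nil.
by rewrite mulrDr -scalerAr -exprD; apply: cone_cons.
Qed.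

Lemma cone_id b : cone b b.
Proof.
rewrite -[X in cone _ X]scale1r -[X in cone _ X]addr0 -[X in _ *: X + _]expr1.
exact: (@cone_cons b 1 1 0 ler01 (cone_nil b)).
Qed.

Lemma posX b n : pos b -> pos (b ^+ n).
Proof.
move=> pb; have sX m : star (b ^+ m) = b ^+ m by rewrite starX pb.1.
rewrite -(odd_double_half n) -addnn !exprD; case: odd; rewrite ?expr0 ?mul1r.
  rewrite expr1 mulrA -exprS exprSr; exact: pos_conj_sa (sX _) pb.
exact: pos_sq (sX _).
Qed.

Lemma cone_pos b x : pos b -> cone b x -> pos x.
Proof.
move=> pb; elim=> [|k n z k0 _ IH]; first exact: pos0.
by apply: posD => //; apply: posZ => //; apply: posX.
Qed.

Lemma half_add x : (1 / 2) *r (x + x) = x.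
Proof.
rewrite scalerDr -scalerDl -rmorphD; have -> : 1 / 2 + 1 / 2 = 1 :> R by lra.
by rewrite rmorph1 scale1r.
Qed.

(* The iteration y <- (b + y^2) / 2 increases to 1 - sqrt (1 - b): its
   differences are polynomials in b with nonnegative coefficients. *)
Lemma sqrt_unit B a : monotone_closed B -> B a -> unit_itv a ->
  exists y, [/\ B y, unit_itv y & y * y = a].
Proof.
move=> hB Ba ua; pose b := 1 - a; have ub : unit_itv b := unit_itvC ua.
have Bb : B b by apply: mclosedB => //; apply: mclosed1.
pose step y := (1 / 2) *r (b + y * y); pose y n := iter n step 0.
have half0 : 0 <= 1 / 2 :> R by lra.
have cy n : cone b (y n).
  elim: n => [|n IH]; first exact: cone_nil.
  by apply: coneZ => //; apply: coneD; [exact: cone_id|exact: coneM].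
have dy n : cone b (y n.+1 - y n).
  elim: n => [|n IH].
    rewrite subr0 /y /= /step mulr0 addr0; apply: coneZ => //; exact: cone_id.
  have -> : y n.+2 - y n.+1 = (1 / 2) *r
     ((y n.+1 - y n) * y n.+1 + y n * (y n.+1 - y n)).
    rewrite [y n.+2]/(step (y n.+1)) [X in _ - X]/(step (y n)) /step -scalerBr.
    by congr (_ *: _); ncring.
  by apply: coneZ => //; apply: coneD; apply: coneM.
have uy n : unit_itv (y n).
  split; first exact: cone_pos ub.1 (cy n).
  elim: n => [|n IH]; first by rewrite subr0; apply: pos1.
  have un : unit_itv (y n) by split=> //; exact: cone_pos ub.1 (cy n).
  have -> : 1 - y n.+1 = (1 / 2) *r ((1 - b) + ((1 - y n) + (y n - y n * y n))).
    rewrite -[X in X - _](half_add 1) -scalerBr; congr (_ *: _).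
    by ncring.
  apply: posZ => //; apply: posD; first exact: ub.2.
  by apply: posD => //; apply: unit_itv_sq.
have my : monotone_unit y by split=> // n; apply: cone_pos ub.1 (dy n).
have [l yl] := monotone_scvg my; have ul := scvg_unit_itv my yl.
have By n : B (y n).
  elim: n => [|n IH]; first exact: mclosed0.
  by apply: mclosedZ => //; apply: mclosedD => //; apply: mclosedM.
have Bl : B l := mclosed_lim hB By my yl.
(* The fixed point equation is equivalent to [(1 - l)^2 = 1 - b = a]. *)
have lE : l = (1 / 2) *r (b + l * l).
  apply: scvg_unique (scvg_shift yl) _; apply: scvgZ; apply: scvgD.
    exact: scvg_const.
  exact: scvg_sq.
exists (1 - l); split; [|exact: unit_itvC|].
  by apply: mclosedB => //; apply: mclosed1.
have -> : (1 - l) * (1 - l) = 1 + l * l - (l + l) by ncring.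
rewrite {3 4}lE -scalerDr half_add /b; by ncring.
Qed.

Lemma sqrt_pos B a : monotone_closed B -> B a -> pos a ->
  exists y, [/\ B y, pos y & y * y = a].
Proof.
move=> hB Ba pa; have [k k0 uk] := pos_unit_itv pa.
have [y [By [py _] yy]] := sqrt_unit hB (mclosedZ _ hB Ba) uk.
exists ((Num.sqrt k^-1) *r y); split; first exact: mclosedZ.
  by apply: posZ => //; apply: sqrtr_ge0.
rewrite -scalerAl -scalerAr yy !scalerA -!rmorphM -expr2 sqr_sqrtr.
  by rewrite mulVf ?gt_eqF // rmorph1 scale1r.
by rewrite invr_ge0 ltW.
Qed.

(** A square root [z] of [x] taken in the bicentralizer of [x] commutes with [y], so the product is
    the conjugate [z y z]. *)
Lemma posM_comm x y : pos x -> pos y -> x * y = y * x -> pos (x * y).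
Proof.
move=> px py xy.
have [z [Bz pz <-]] :=
  sqrt_pos (mclosed_bicentralizer px.1) (@bicentralizer_id x) px.
have -> : z * z * y = z * y * z by rewrite -!mulrA (Bz y) // => w ->.
exact: pos_conj_sa pz.1 py.
Qed.

(** Neumann series with [r = 1 - k t] in the unit interval. The partial sums increase, and [t >= 1]
    bounds them by 1 through [1 - s n = s n (t - 1) + r ^+ n]. *)
Lemma inverse_ge1 B t : monotone_closed B -> B t -> pos (t - 1) ->
  exists c, [/\ B c, pos c & c * t = 1].
Proof.
move=> hB Bt pt; have pt0 : pos t by rewrite -[t](subrK 1); apply: posD => //;
  exact: pos1.
have [k k0 [pk qk]] := pos_unit_itv pt0; pose r := 1 - k *r t.
pose s n := \sum_(i < n) k *r r ^+ i.
have ur : unit_itv r by apply: unit_itvC.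
have Br : B r by apply: mclosedB (mclosed1 hB) (mclosedZ _ hB Bt).
have Bs n : B (s n).
  rewrite /s; elim/big_ind: _ => [|x y|i _]; [exact: mclosed0|exact: mclosedD|].
  by apply: mclosedZ => //; apply: mclosedX.
have ps n : pos (s n).
  rewrite /s; elim/big_ind: _ => [|x y|i _]; [exact: pos0|exact: posD|].
  by apply: posZ; [exact: ltW|exact: posX ur.1].
have sS n : s n.+1 = s n + k *r r ^+ n by rewrite /s big_ord_recr.
have st n : s n * t = 1 - r ^+ n.
  elim: n => [|n IH]; first by rewrite /s big_ord0 mul0r subrr.
  have -> : s n.+1 * t = s n * t + r ^+ n * (k *r t).
    by rewrite sS mulrDl -scalerAl scalerAr.
  have -> : k *r t = 1 - r by rewrite /r opprB addrC subrK.
  by rewrite IH exprSr; ncring.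
have ts n : t * s n = s n * t.
  by rewrite -[LHS]starK starM (ps n).1 pt0.1 st starB star1 (posX n ur.1).1.
have us n : unit_itv (s n).
  split=> //; have -> : 1 - s n = s n * (t - 1) + (1 - s n * t) by ncring.
  apply: posD; last by rewrite st opprB addrC subrK; apply: posX ur.1.
  by apply: posM_comm => //; rewrite mulrBr mulrBl ts mulr1 mul1r.
have ms : monotone_unit s.
  split=> // n; rewrite sS addrC addKr; apply: posZ; [exact: ltW|exact: posX ur.1].
have [l sl] := monotone_scvg ms; exists l; split.
- exact: mclosed_lim Bs ms sl.
- by case: (scvg_unit_itv ms sl).
(* The recursion gives [l = k + l r] in the limit, hence [l t = 1], without showing that [r ^+ n]
   tends to 0. *)
have h : scvg (fun n => s n.+1) (k *r 1 + l * r).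
  rewrite [X in scvg X](_ : _ = (fun n => k *r 1 + s n * r)).
    by apply: scvgD; [exact: scvg_const|exact: scvgMr].
  apply/funext => n; rewrite /s big_ord_recl expr0; congr (_ + _).
  by rewrite mulr_suml; apply: eq_bigr => i _; rewrite -scalerAl -exprSr.
have : k *r (l * t) = k *r 1.
  rewrite scalerAr; have -> : k *r t = 1 - r by rewrite /r opprB addrC subrK.
  by rewrite mulrBr mulr1 {1}(scvg_unique (scvg_shift sl) h) addrK.
by apply: scalerI; rewrite (fmorph_eq0 (real_complex R)) gt_eqF.
Qed.

Definition projection (e : A) := star e = e /\ e * e = e.

(** The strong limit of [1 - r ^+ n], with [r = 1 - k a], projects onto the closed range of [a].
    Each increment [r ^+ n * a'] has a factor [a], so whatever annihilates [a] annihilates the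
    limit. *)
Lemma support_projection B a : monotone_closed B -> B a -> pos a ->
  exists e, [/\ B e, projection e, a * e = a &
    forall x, x * a = 0 -> x * e = 0].
Proof.
move=> hB Ba pa; have [k k0 [pk qk]] := pos_unit_itv pa.
set a' := k *r a in pk qk; pose r := 1 - a'.
have ur : unit_itv r by apply: unit_itvC.
pose s n := 1 - r ^+ n.
have sS n : s n.+1 - s n = r ^+ n * a'.
  by rewrite /s exprSr -[in RHS](subKr 1 a') -/r; ncring.
have ra n : r ^+ n * a' = a' * r ^+ n.
  by apply/esym/commrX; rewrite /GRing.comm /r; ncring.
have ms : monotone_unit s.
  split=> n; last by rewrite sS; apply: posM_comm => //; apply: posX ur.1.
  elim: n => [|n IH]; first by rewrite /s subrr; apply: unit_itv0.
  split; last by rewrite /s opprB addrC subrK; apply: posX ur.1.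
  rewrite -(subrK (s n) (s n.+1)) sS; apply: posD; last exact: IH.1.
  by apply: posM_comm => //; apply: posX ur.1.
have [e se] := monotone_scvg ms; have ue := scvg_unit_itv ms se.
have Bs n : B (s n).
  apply: mclosedB (mclosed1 hB) _ => //; apply: mclosedX => //.
  apply: mclosedB (mclosed1 hB) _ => //; exact: mclosedZ.
(* Every power of [r] then fixes [1 - e], and the limit over the powers makes [1 - e] idempotent. *)
have re : r * (1 - e) = 1 - e.
  have h : scvg (fun n => r * (1 - s n)) (r * (1 - e)).
    by apply: scvgMl; apply: scvgB => //; exact: scvg_const.
  have h' : scvg (fun n => 1 - s n.+1) (1 - e).
    by apply: scvgB; [exact: scvg_const|exact: scvg_shift].
  apply: scvg_unique h _; congr (scvg _ _) : h'; apply/funext => n.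
  by rewrite /s !opprB ![1 + _]addrC !subrK exprS.
have rne n : r ^+ n * (1 - e) = 1 - e.
  by elim: n => [|n IH]; rewrite ?expr0 ?mul1r // exprSr -mulrA re.
have pp : (1 - e) * (1 - e) = 1 - e.
  have h : scvg (fun n => (1 - s n) * (1 - e)) ((1 - e) * (1 - e)).
    by apply: scvgMr; apply: scvgB => //; exact: scvg_const.
  apply: scvg_unique h _; rewrite [X in scvg X](_ : _ = fun=> 1 - e).
    exact: scvg_const.
  by apply/funext => n; rewrite /s opprB addrC subrK.
have kn0 : k%:C%C != 0 by rewrite (fmorph_eq0 (real_complex R)) gt_eqF.
exists e; split.
- exact: mclosed_lim Bs ms se.
- split; first exact: ue.1.1.
  have -> : e * e = (1 - e) * (1 - e) - 1 + e + e by ncring.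
  by rewrite pp; ncring.
- apply: (scalerI kn0); rewrite scalerAl -/a'.
  have -> : a' = 1 - r by rewrite /r opprB addrC subrK.
  have -> : (1 - r) * e = 1 - r - ((1 - e) - r * (1 - e)) by ncring.
  by rewrite re subrr subr0.
- move=> x xa; apply: (@scvg_unique _ _ _ _ _ (fun n => x * s n)).
    exact: scvgMl.
  rewrite [X in scvg X](_ : _ = fun=> 0); first exact: scvg_const.
  apply/funext; elim=> [|n IH]; first by rewrite /s subrr mulr0.
  by rewrite -(subrK (s n) (s n.+1)) sS mulrDr IH ra mulrA -scalerAr xa scaler0
    mul0r addr0.
Qed.

(* e is the spectral projection of a for an interval (eps, oo) and
   d = a^(-1/2) e. *)
Lemma spectral_projection B a : monotone_closed B -> B a -> pos a -> a != 0 ->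
  exists d e, [/\ B d, B e, projection e, e != 0 &
    [/\ star d = d, d * a * d = e & e = d * d * a]].
Proof.
move=> hB Ba pa an0.
have [v av] : exists v, 0 < rd (a v) v.
  apply/not_existsP => h; move/eqP: an0; apply; apply: pos_quad0 pa.1 _ => v.
  apply/eqP; rewrite eq_le pa.2 andbT leNgt; apply/negP; exact: h.
have v0 : v != 0 by apply: contraTneq av => ->; rewrite rdot0r ltxx.
(* Half the Rayleigh quotient of [a] at [v]: then [a <= eps] fails, and the projection for
   [(eps, oo)] is not 0. *)
have nv := hnorm_gt0 v0; pose eps := rd (a v) v / (2 * hnorm v ^+ 2).
have eps0 : 0 < eps by rewrite divr_gt0 // mulr_gt0 // exprn_gt0.
have avE : rd (a v) v = 2 * eps * hnorm v ^+ 2.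
  rewrite -mulrA mulrCA /eps divfK //.
  by rewrite mulf_neq0 ?pnatr_eq0 // expf_neq0 // gt_eqF.
have hB0 := mclosedI hB (mclosed_bicentralizer pa.1).
set B0 := _ `&` _ in hB0; have B0a : B0 a by split=> //; exact: bicentralizer_id.
have B0C x y : B0 x -> B0 y -> x * y = y * x.
  by move=> [_ hx] [_ hy]; exact: bicentralizer_comm hx hy.
pose r := eps^-1 *r a - 1.
have B0r : B0 r by apply: mclosedB (mclosedZ _ hB0 B0a) (mclosed1 hB0).
have sr : star r = r by rewrite /r starB star_rZ star1 pa.1.
have [m [B0m pm mm]] := sqrt_pos hB0 (mclosedM hB0 B0r B0r) (pos_sq sr).
(* [m] is the absolute value of [r]; [f] and [g] are its positive and negative parts. *)
pose f := (1 / 2) *r (m + r); pose g := (1 / 2) *r (m - r).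
have B0f : B0 f by apply: mclosedZ => //; apply: mclosedD.
have B0g : B0 g by apply: mclosedZ => //; apply: mclosedB.
have sf : star f = f by rewrite /f star_rZ starD pm.1 sr.
have fDg : f + g = m.
  rewrite /f /g -scalerDr [m + r + _](_ : _ = m + m) ?half_add //; by ncring.
have fBg : f - g = r.
  rewrite /f /g -scalerBr [m + r - _](_ : _ = r + r) ?half_add //; by ncring.
have gf : g * f = 0.
  rewrite /f /g -scalerAl -scalerAr.
  rewrite [X in _ *: (_ *: X)](_ : _ = m * m - r * r + (m * r - r * m));
    last by ncring.
  by rewrite mm (B0C m r) // !subrr addr0 !scaler0.
(* The support is taken of the square because [f] is not yet known to be positive; that follows from
   [f = e m e]. *)
have [e [B0e [se ee] ffe he]] :=
  support_projection hB0 (mclosedM hB0 B0f B0f) (pos_sq sf).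
have ge : g * e = 0 by apply: he; rewrite mulrA gf mul0r.
have fe : f * e = f.
  apply/eqP; rewrite -subr_eq0; apply/eqP/starM_eq0.
  rewrite starB starM se sf.
  have -> : (e * f - f) * (f * e - f) = (1 - e) * (f * f - f * f * e) by ncring.
  by rewrite ffe subrr mulr0.
have fpos : pos f.
  rewrite -fe; have -> : f * e = e * m * e.
    by rewrite -fDg (B0C e) -?mulrA ?ee ?mulrDl ?ge ?addr0 //; apply: mclosedD.
  exact: pos_conj_sa se pm.
have en0 : e != 0.
  apply/eqP => e0; move: fe; rewrite e0 mulr0 => /esym f0.
  move: fDg fBg; rewrite f0 add0r sub0r => -> rE.
  have [_ /(_ v)] := pm; rewrite -[m]opprK rE /r !opE rdotNl rdotBl rdotZl avE.
  rewrite -(hnorm_sq hdot) (mulrC 2) -(mulrA eps) mulKf ?gt_eqF //.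
  by have := exprn_gt0 2 nv; lra.
have pf1 : pos (f + 1 - 1) by rewrite addrK.
have B0f1 : B0 (f + 1) by apply: mclosedD => //; apply: mclosed1.
(* Under [e] one has [a = eps (f + 1)], so the square root [q] of [eps^-1 c] acts there as the
   inverse square root of [a]. *)
have [c [B0c pc cf]] := inverse_ge1 hB0 B0f1 pf1.
have [q [B0q pq qq]] := sqrt_pos hB0 (mclosedZ (eps^-1)%:C%C hB0 B0c)
   (posZ (ltW (etrans (invr_gt0 _) eps0)) pc).
have ace : eps^-1 *r c * a * e = e.
  rewrite -scalerAl scalerAr.
  have -> : eps^-1 *r a = r + 1 by rewrite /r subrK.
  rewrite -fBg -mulrA [X in c * X](_ : _ = (f + 1) * e) ?mulrA ?cf ?mul1r //.
  by rewrite !mulrDl mulNr ge subr0.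
have qe : q * e = e * q by apply: B0C.
have B0d : B0 (q * e) by apply: mclosedM.
have dd : q * e * (q * e) * a = e.
  have -> : q * e * (q * e) = q * q * e
    by rewrite {2}qe mulrA -(mulrA q) ee -mulrA -qe mulrA.
  by rewrite qq -mulrA (B0C e a) // mulrA.
exists (q * e), e; split=> //; [exact: B0d.1|exact: B0e.1|].
split; first by rewrite starM se pq.1 qe.
  by rewrite (B0C (q * e) a) // -mulrA (B0C a) //; apply: mclosedM.
by rewrite dd.
Qed.

End MonotoneClosed.

(** * Automorphisms preserve monotone limits; normal traces *)

Section Automorphisms.
Variables (R : realType) (H : completeNormedModType R[i]).
Variable dot : {dot H for Num.conj}.
Variables (M : set (H -> H)) (hM : star_algebra dot M).
Local Notation A := (opalg hM).
Local Notation rd := (rdot dot).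
Local Notation "a *r x" := (a%:C%C *: x) (at level 40).
Implicit Types (x y z : A) (v w : H) (k : R) (f : A -> A).

Record star_auto f : Prop := StarAuto {
  auto_lin : forall c x y, f (c *: x + y) = c *: f x + f y;
  autoM : forall x y, f (x * y) = f x * f y;
  auto_star : forall x, f (star x) = star (f x);
  auto_bij : exists2 h, cancel f h & cancel h f }.

Lemma autoD f x y : star_auto f -> f (x + y) = f x + f y.
Proof. by move=> hf; rewrite -[x]scale1r auto_lin // !scale1r. Qed.

Lemma auto0 f : star_auto f -> f 0 = 0.
Proof. by move=> hf; apply: (addIr (f 0)); rewrite -autoD // !add0r. Qed.

Lemma autoZ f c x : star_auto f -> f (c *: x) = c *: f x.
Proof. by move=> hf; rewrite -[c *: x]addr0 auto_lin // auto0 // addr0. Qed.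

Lemma autoN f x : star_auto f -> f (- x) = - f x.
Proof. by move=> hf; rewrite -scaleN1r autoZ // scaleN1r. Qed.

Lemma autoB f x y : star_auto f -> f (x - y) = f x - f y.
Proof. by move=> hf; rewrite autoD // autoN. Qed.

Lemma auto1 f : star_auto f -> f 1 = 1.
Proof.
move=> hf; have [h _ hK] := auto_bij hf.
by have := autoM hf 1 (h 1); rewrite mul1r hK mulr1.
Qed.

Lemma auto_sum f (I : Type) (r : seq I) (P : pred I) (F : I -> A) :
  star_auto f -> f (\sum_(i <- r | P i) F i) = \sum_(i <- r | P i) f (F i).
Proof.
by move=> hf; apply: (big_morph f) => [x y|]; [exact: autoD|exact: auto0].
Qed.

Lemma auto_inv f h : star_auto f -> cancel f h -> cancel h f -> star_auto h.
Proof.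
move=> hf fK hK; split.
- by move=> c x y; apply: (can_inj fK); rewrite (auto_lin hf) !hK.
- by move=> x y; apply: (can_inj fK); rewrite (autoM hf) !hK.
- by move=> x; apply: (can_inj fK); rewrite (auto_star hf) !hK.
- by exists f.
Qed.

Lemma auto_pos f x : star_auto f -> pos x -> pos (f x).
Proof.
move=> hf px; have [y [_ py <-]] := sqrt_pos (mclosedT hM) (I : setT x) px.
by rewrite autoM //; apply: pos_sq; rewrite -auto_star // py.1.
Qed.

Lemma auto_unit_itv f x : star_auto f -> unit_itv x -> unit_itv (f x).
Proof.
move=> hf [px qx]; split; first exact: auto_pos.
by rewrite -(auto1 hf) -autoB //; apply: auto_pos.
Qed.

Lemma auto_monotone f (x : nat -> A) :
  star_auto f -> monotone_unit x -> monotone_unit (f \o x).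
Proof.
move=> hf [ux hx]; split=> n; first exact: auto_unit_itv.
by rewrite /= -autoB //; apply: auto_pos.
Qed.

(** The images increase to some [m]. Order preservation by [f] gives [m <= f l], and by its inverse
    [h] gives [l <= h m]. *)
Lemma auto_scvg f (x : nat -> A) l :
  star_auto f -> monotone_unit x -> scvg x l -> scvg (f \o x) (f l).
Proof.
move=> hf mx xl; have [h fK hK] := auto_bij hf; have hh := auto_inv hf fK hK.
have mfx := auto_monotone hf mx; have [m xm] := monotone_scvg mfx.
suff -> : f l = m by [].
apply/eqP; rewrite -subr_eq0; apply/eqP/pos_antisym.
  by apply: (scvg_le _ xm) => n; rewrite /= -autoB //; apply/auto_pos/scvg_ge.
rewrite opprB -[m]hK -autoB //; apply: auto_pos => //.
apply: (scvg_le _ xl) => n; rewrite -[x n]fK -autoB //; apply: auto_pos => //.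
exact: (scvg_ge n mfx xm).
Qed.

Definition fixed_by (I : Type) (F : I -> A -> A) : set A :=
  [set x | forall i, F i x = x].

Lemma mclosed_fixed_by (I : Type) (F : I -> A -> A) :
  (forall i, star_auto (F i)) -> monotone_closed (fixed_by F).
Proof.
move=> hF; split.
- by move=> i; apply: auto1.
- by move=> c x y hx hy i; rewrite auto_lin // hx hy.
- by move=> x y hx hy i; rewrite autoM // hx hy.
- by move=> x hx i; rewrite auto_star // hx.
- move=> x l hx mx xl i; apply: scvg_unique (auto_scvg (hF i) mx xl) _.
  by congr (scvg _ _) : xl; apply/funext => n; rewrite /= hx.
Qed.

(** Normality says that an upper bound survives an increasing limit; with positivity this is
    continuity along the sequence. *)
Record normal_trace (tr : A -> R) : Prop := NormalTrace {
  trD : forall x y, tr (x + y) = tr x + tr y;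
  trZ : forall k x, tr (k *r x) = k * tr x;
  trC : forall x y, tr (x * y) = tr (y * x);
  tr1 : tr 1 = 1;
  tr_ge0 : forall x, pos x -> 0 <= tr x;
  tr_eq0 : forall x, pos x -> tr x = 0 -> x = 0;
  tr_normal : forall (x : nat -> A) l t, monotone_unit x -> scvg x l ->
    (forall n, tr (x n) <= t) -> tr l <= t }.

Lemma normal_trace_auto tr f : normal_trace tr -> star_auto f -> normal_trace
  (tr \o f).
Proof.
move=> ht hf; split.
- by move=> x y /=; rewrite autoD // trD.
- by move=> k x /=; rewrite autoZ // trZ.
- by move=> x y /=; rewrite !autoM // trC.
- by rewrite /= auto1 // tr1.
- by move=> x px /=; apply/tr_ge0/auto_pos.
- move=> x px /= /(tr_eq0 ht (auto_pos hf px)) fx0.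
  by have [h fK _] := auto_bij hf; apply: (can_inj fK); rewrite fx0 auto0.
- move=> x l t mx xl hx; apply: (tr_normal ht (auto_monotone hf mx)) hx.
  exact: auto_scvg.
Qed.

Lemma dot_sa x v : star x = x -> dot (x v) v = (rd (x v) v)%:C%C.
Proof.
move=> sx; rewrite dotE; congr Complex.
have : rd (x v) ('i%C *: v) = - rd (x v) ('i%C *: v); last by lra.
rewrite {1}rdot_star sx opZ rdotC rdot_conj -rdotNr -scaleNr.
by rewrite conjc_i.
Qed.

End Automorphisms.

(** * An exhaustion principle *)

Section OrderingPrinciple.
Variables (R : realType) (T : Type) (P : set T) (le : T -> T -> Prop) (m : T -> R).
Hypothesis le_refl : forall x, P x -> le x x.
Hypothesis le_tr : forall y x z, P x -> P y -> P z -> le x y -> le y z -> le x z.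
Hypothesis m_mono : forall x y, P x -> P y -> le x y -> m x <= m y.
Hypothesis m_bounded : exists K, forall x, P x -> m x <= K.
Hypothesis chain_bound : forall x : nat -> T, (forall n, P (x n)) ->
  (forall n, le (x n) (x n.+1)) -> exists2 y, P y & forall n, le (x n) y.

(** Stage [n] picks an extension whose measure is within [1/(n+1)] of the supremum over all
    extensions. Anything above an upper bound of this chain extends every stage, so it cannot have
    larger measure. *)
Lemma maximal_element x0 : P x0 ->
  exists y, [/\ P y, le x0 y & forall z, P z -> le y z -> m z = m y].
Proof.
move=> Px0.
have step (p : nat * T) : exists y, P p.2 -> [/\ P y, le p.2 y &
    forall z, P z -> le p.2 z -> m z <= m y + p.1.+1%:R^-1].
  case: p => n x /=; have [Px|nPx] := pselect (P x); last by exists x.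
  pose E := [set m z | z in [set z | P z /\ le x z]].
  have hE : has_sup E.
    split; first by exists (m x), x => //; split=> //; apply: le_refl.
    by have [K hK] := m_bounded; exists K => _ [z [Pz _] <-]; apply: hK.
  have e0 : 0 < n.+1%:R^-1 :> R by rewrite invr_gt0.
  have [_ [y [Py xy] <-] hy] := sup_adherent e0 hE.
  exists y => _; split=> // z Pz xz.
  have : m z <= sup E by apply: ub_le_sup; [exact: hE.2|exists z].
  by move/le_lt_trans => h; rewrite ltrBlDr in hy; apply/ltW/h.
have [F hF] := choice step.
pose x := fix x n := if n is n'.+1 then F (n', x n') else x0.
have Px n : P (x n) by elim: n => [|n IH] //=; case: (hF (n, x n) IH).
have lex n : le (x n) (x n.+1) by case: (hF (n, x n) (Px n)).
have [y Py hy] := chain_bound Px lex.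
exists y; split=> //; first exact: (hy 0%N).
move=> z Pz yz; apply/eqP; rewrite eq_le (m_mono Py Pz yz) andbT leNgt.
apply/negP => /ltr_add_invr[n hn].
have [_ _ /(_ z Pz (le_tr (Px n) Py Pz (hy n) yz))] := hF (n, x n) (Px n).
have := m_mono (Px n.+1) Py (hy n.+1); rewrite /= => h1 h2.
by have := lt_le_trans hn h2; rewrite ltrD2r ltNge h1.
Qed.

End OrderingPrinciple.

(** * Comparison of the trace with vector functionals *)

Section Domination.
Variables (R : realType) (H : completeNormedModType R[i]).
Variable dot : {dot H for Num.conj}.
Variables (M : set (H -> H)) (hM : star_algebra dot M).
Local Notation A := (opalg hM).
Local Notation rd := (rdot dot).
Local Notation "a *r x" := (a%:C%C *: x) (at level 40).
Implicit Types (x y z b : A) (v w : H) (k : R).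

Let hdot := star_algebra_form hM.

Record positive_normal (phi : A -> R) : Prop := PositiveNormal {
  pnD : forall x y, phi (x + y) = phi x + phi y;
  pnZ : forall k x, phi (k *r x) = k * phi x;
  pn_ge0 : forall x, pos x -> 0 <= phi x;
  pn_normal : forall (x : nat -> A) l t, monotone_unit x -> scvg x l ->
    (forall n, phi (x n) <= t) -> phi l <= t }.

Lemma pnB (phi : A -> R) x y : positive_normal phi -> phi (x - y) = phi x - phi y.
Proof.
move=> hp; have -> : x - y = x + (-1) *r y by rewrite rmorphN1 scaleN1r.
by rewrite pnD // pnZ // mulN1r.
Qed.

Lemma pn_le (phi : A -> R) x y : positive_normal phi -> pos (y - x) -> phi x <=
  phi y.
Proof. by move=> hp /(pn_ge0 hp); rewrite pnB // subr_ge0. Qed.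

Lemma normal_trace_pn (tr : A -> R) : normal_trace tr -> positive_normal tr.
Proof. by case=> h1 h2 h3 h4 h5 h6 h7; split. Qed.

Definition vector_functional v x := rd (x v) v.

Lemma vector_functional_pn v : positive_normal (vector_functional v).
Proof.
split=> [x y|k x|x px|x l t mx xl hx]; rewrite /vector_functional.
- by rewrite opE rdotDl.
- by rewrite opE rdotZl.
- exact: px.2.
- have /cvgr_to_le := @hcvg_rdot _ _ _ hdot _ _ v (xl v).
  by apply; apply: nearW.
Qed.

Lemma pn_scale (phi : A -> R) k : 0 <= k -> positive_normal phi ->
  positive_normal (fun x => k * phi x).
Proof.
move=> k0 hp; split=> [x y|j x|x px|x l t mx xl hx].
- by rewrite pnD // mulrDr.
- by rewrite pnZ // mulrCA.
- by rewrite mulr_ge0 // pn_ge0.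
- have [k0'|->] : 0 < k \/ k = 0.
    by have := k0; rewrite le_eqVlt => /orP[/eqP<-|]; [right|left].
  + rewrite mulrC -ler_pdivlMr //; apply: (pn_normal hp mx xl) => n.
    by rewrite ler_pdivlMr // mulrC.
  + by rewrite mul0r; have := hx 0%N; apply: le_trans;
    rewrite mulr_ge0 // (pn_ge0 hp) //; case: (mx.1 0%N).
Qed.

(* b0 - b is a maximal h <= b0 with psi h <= phi h. *)
Lemma domination (tr phi psi : A -> R) b0 : normal_trace tr -> positive_normal phi ->
  positive_normal psi -> unit_itv b0 -> phi b0 < psi b0 ->
  exists b, [/\ pos b, pos (b0 - b), b <> 0 &
    forall z, pos z -> pos (b - z) -> psi z <= phi z -> z = 0].
Proof.
move=> htr hphi hpsi [pb0 qb0] lt0; have ptr := normal_trace_pn htr.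
pose P h := [/\ pos h, pos (b0 - h) & psi h <= phi h].
pose le x y := pos (y - x).
have P0 : P 0.
  split; [exact: pos0|by rewrite subr0|].
  by rewrite -[0](subrr b0) !pnB // !subrr.
have [|||||h [[ph qh hle] _ hmax]] := @maximal_element _ _ P le tr _ _ _ _ _ 0 P0.
- by move=> x _; rewrite /le subrr; apply: pos0.
- move=> y x z _ _ _ xy yz; rewrite /le -(subrK y z) -addrA; exact: posD.
- by move=> x y _ _; apply: pn_le.
- by exists (tr b0) => x [_ hx _]; apply: pn_le.
- move=> x Px lex; have ux n : unit_itv (x n).
    have [px qx _] := Px n; split=> //.
    by rewrite -(subrK b0 1) -addrA; apply: posD.
  have mx : monotone_unit x by [].
  have [l xl] := monotone_scvg mx; exists l; last by move=> n; apply: scvg_ge mx xl.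
  have ul := scvg_unit_itv mx xl; split; first by case: ul.
    by apply: scvg_le xl => n; case: (Px n).
  apply: (pn_normal hpsi mx xl) => n; have [_ _ hn] := Px n.
  by apply: le_trans hn _; apply: pn_le => //; apply: scvg_ge mx xl.
exists (b0 - h); split=> //.
- by rewrite opprB addrC subrK.
- by move/eqP; rewrite subr_eq0 => /eqP e; move: lt0; rewrite e ltNge hle.
move=> k pk qk hk.
have Phk : P (h + k).
  split; [exact: posD|by rewrite opprD addrA|].
  by rewrite !pnD // lerD.
have := hmax _ Phk; rewrite /le addrAC subrr add0r => /(_ pk).
rewrite pnD // => /eqP; rewrite -subr_eq0 addrAC subrr add0r => /eqP.
exact: (tr_eq0 htr pk).
Qed.

(** For [0 <= z <= 1] the element [b z b] lies below [b], since
    [b - b z b = (b - b b) + b (1 - z) b]. Rescaling [star y * y] into the unit interval spreads the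
    domination under [b] to the whole corner. *)
Lemma dominated_conj (phi psi : A -> R) b : positive_normal phi ->
  positive_normal psi ->
  unit_itv b ->
  (forall z, pos z -> pos (b - z) -> psi z <= phi z -> z = 0) ->
  forall y, phi (b * (star y * y) * b) <= psi (b * (star y * y) * b).
Proof.
move=> hphi hpsi ub hb y; have [k k0 [pz qz]] := pos_unit_itv (pos_starM y).
set z := k *r _ in pz qz; have sb := ub.1.1.
have [h|/ltW h] := leP (psi (b * z * b)) (phi (b * z * b)).
  have z0 : b * z * b = 0.
    apply: hb => //; first exact: pos_conj_sa.
    have -> : b - b * z * b = (b - b * b) + b * (1 - z) * b by ncring.
    apply: posD; first exact: unit_itv_sq.
    exact: pos_conj_sa.
  have -> : b * (star y * y) * b = 0; last by rewrite -[0](subrr b) !pnB // !subrr.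
  apply/eqP; move/eqP: z0; rewrite /z -scalerAr -scalerAl scaler_eq0.
  by rewrite (fmorph_eq0 (real_complex R)) gt_eqF.
by move: h; rewrite /z -scalerAr -scalerAl !pnZ // ler_pM2l.
Qed.

Lemma vector_functional_starM v y : vector_functional v (star y * y) = hnorm (y
  v) ^+ 2.
Proof. exact: rdot_starM. Qed.

Lemma exists_neq0 : exists v : H, v != 0.
Proof.
apply/not_existsP => h; apply: (star_algebra_neq0 hM); apply/funext => v.
by apply/eqP/negPn/negP; apply: h.
Qed.

(** One half of a passage from one vector to another through the trace; [trace_bounded_above] is the
    other half and [dominated_vectors] chains them. *)
Lemma trace_bounded_below (tr : A -> R) : normal_trace tr ->
  exists b v C, [/\ b <> 0, star b = b, 0 <= C &
    forall y, tr (b * (star y * y) * b) <= C * hnorm (y v) ^+ 2].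
Proof.
move=> htr; have ptr := normal_trace_pn htr; have [v /hnorm_gt0 v0] := exists_neq0.
(* The scaled vector functional then has value 2 at the identity, strictly above [tr 1 = 1]. *)
pose C := 2 / hnorm v ^+ 2; have C0 : 0 <= C.
  by rewrite divr_ge0 ?exprn_ge0 ?hnorm_ge0.
have u1 : unit_itv (1 : A) by rewrite -[1]subr0; apply/unit_itvC/unit_itv0.
have pv := pn_scale C0 (vector_functional_pn v).
have lt1 : tr 1 < C * vector_functional v 1.
  rewrite tr1 // /vector_functional opE -(hnorm_sq hdot) divfK ?ltr1n //.
  by rewrite expf_neq0 // gt_eqF.
have [b [pb qb b0 hb]] := domination htr ptr pv u1 lt1.
exists b, (b v), C; split=> // [|y]; first exact: pb.1.
have := dominated_conj ptr pv (conj pb qb) hb y.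
rewrite /= (_ : b * (star y * y) * b = star (y * b) * (y * b)); last first.
  by rewrite starM pb.1; ncring.
by rewrite vector_functional_starM.
Qed.

Lemma trace_bounded_above (tr : A -> R) : normal_trace tr ->
  exists v C, [/\ v != 0, 0 <= C & forall y,
    hnorm (y v) ^+ 2 <= C * tr (star y * y)].
Proof.
move=> htr; have ptr := normal_trace_pn htr; have [v v0] := exists_neq0.
have u1 : unit_itv (1 : A) by rewrite -[1]subr0; apply/unit_itvC/unit_itv0.
have pv := vector_functional_pn v.
have pn00 : positive_normal (fun=> 0).
  by split=> // [*|*|x l t _ _ /(_ 0%N)] //; rewrite ?addr0 ?mulr0.
(* First cut down to the support of v, so that b v does not vanish. *)
have lt1 : 0 < vector_functional v 1.
  by rewrite /vector_functional opE -(hnorm_sq hdot) exprn_gt0 // hnorm_gt0.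
have [b1 [pb1 qb1 b10 hb1]] := domination htr pn00 pv u1 lt1.
have t1 : 0 < tr b1.
  by rewrite lt_neqAle tr_ge0 // andbT eq_sym; apply/eqP => /(tr_eq0 htr pb1).
(* The added 1 provides the strict inequality that [domination] asks for. *)
pose C := (vector_functional v b1 + 1) / tr b1.
have C0 : 0 <= C.
  by apply: divr_ge0; [rewrite addr_ge0 // (pn_ge0 pv)|exact: ltW].
have pC := pn_scale C0 ptr.
have lt2 : vector_functional v b1 < C * tr b1 by rewrite divfK ?gt_eqF //; lra.
have [b [pb qb b0 hb]] := domination htr pv pC (conj pb1 qb1) lt2.
have ub : unit_itv b by split=> //; rewrite -(subrK b1 1) -addrA; apply: posD.
exists (b v), C; split=> //.
  apply/eqP => bv; apply: b0; apply: hb1 => //.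
  by rewrite /vector_functional bv rdot0l.
move=> y; have := dominated_conj pv pC ub hb y.
rewrite /= (_ : b * (star y * y) * b = star (y * b) * (y * b)); last first.
  by rewrite starM pb.1; ncring.
rewrite vector_functional_starM => /le_trans; apply; apply: ler_wpM2l => //.
(* The trace property moves [b] inside, where [y b b (star y) <= y (star y)]. *)
rewrite [leLHS]trC // [leRHS]trC //; apply: pn_le => //.
have -> : y * star y - y * b * star (y * b) = star (star y) * ((1 - b) + (b - b
  * b)) * star y.
  by rewrite starM pb.1 starK; ncring.
by apply: pos_conj; apply: posD; [exact: ub.2|exact: unit_itv_sq].
Qed.

End Domination.

(** * Riesz representation of a functional bounded along a linear map *)

Section Riesz.
Variables (R : realType) (H : completeNormedModType R[i]).
Variable dot : {dot H for Num.conj}.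
Hypothesis hdot : induces_norm dot.
Variables (V : lmodType R[i]) (e : V -> H) (f : V -> R) (k : R).
Local Notation rd := (rdot dot).
Local Notation "a *r x" := (a%:C%C *: x) (at level 40).
Hypothesis eD : forall x y, e (x + y) = e x + e y.
Hypothesis eZ : forall a x, e (a *r x) = a *r e x.
Hypothesis fD : forall x y, f (x + y) = f x + f y.
Hypothesis fZ : forall a x, f (a *r x) = a * f x.
Hypothesis f_bounded : forall x, `|f x| <= k * hnorm (e x).

(** The vector [s] is the limit of a minimizing sequence of [F], so it lies in the closure of the
    range of [e]; there [riesz_unique] makes it unique. *)
Lemma riesz : exists s, (forall x, rd s (e x) = f x) /\
  exists y : nat -> V, hcvg (e \o y) s.
Proof.
pose F x := hnorm (e x) ^+ 2 - 2 * f x.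
have hF : has_inf (range F).
  split; first by exists (F 0), 0.
  exists (- k ^+ 2) => _ [x _ <-]; rewrite /F.
  have := f_bounded x; rewrite ler_norml => /andP[_].
  by have := sqr_ge0 (hnorm (e x) - k); rewrite sqrrB; lra.
set I := inf (range F).
have FI x : I <= F x by apply: ge_inf; [exact: hF.2|exists x].
have near n : exists x, F x < I + n.+1%:R^-1.
  have [_ [x _ <-] hx] := inf_adherent (etrans (invr_gt0 _) (ltr0Sn R n)) hF.
  by exists x.
have [y hy] := choice near.
have half2 x : F ((1 / 2) *r x) = hnorm (e x) ^+ 2 / 4 - f x.
  rewrite /F eZ fZ !(hnorm_sq hdot) rdotZl rdotZr; lra.
(* By the parallelogram law the squared distance of two images is [2 F(y m) + 2 F(y n)] minus [4 F]
   at the midpoint, hence less than [4/(N+1)]. *)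
have [s ys] : exists s, hcvg (e \o y) s.
  apply: hcauchy => eps eps0.
  have e2 : 0 < eps ^+ 2 / 4 by rewrite divr_gt0 ?exprn_gt0.
  have [N] := ltr_add_invr e2; rewrite add0r => hN.
  exists N => m n Nm Nn;
    rewrite -(ltr_pXn2r (ltn0Sn 1)) ?nnegrE ?hnorm_ge0 1?ltW //=.
  have := FI ((1 / 2) *r (y m + y n)); rewrite half2 eD fD (hnormD_sq hdot) => h.
  rewrite (hnormB_sq hdot).
  have inv j : (N <= j)%N -> j.+1%:R^-1 <= N.+1%:R^-1 :> R.
    by move=> Nj; rewrite lef_pV2 ?posrE ?ltr0Sn // ler_nat ltnS.
  have := lt_le_trans (hy m) (lerD (lexx I) (inv m Nm)).
  have := lt_le_trans (hy n) (lerD (lexx I) (inv n Nn)).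
  move: h hN; rewrite /F; set d := N.+1%:R^-1; lra.
exists s; split; last by exists y.
move=> x; pose D := rd s (e x) - f x; pose N2 := hnorm (e x) ^+ 2.
(* First variation: compare [y n] with [y n + t x] and let [n] grow. *)
have key t : 0 <= 2 * t * D + t ^+ 2 * N2.
  have h n : - n.+1%:R^-1 <= 2 * t * (rd (e (y n)) (e x) - f x) + t ^+ 2 * N2.
    have := hy n; have := FI (y n + t *r x).
    rewrite /F eD eZ fD fZ (hnormD_sq hdot) rdotZr !(hnorm_sq hdot (_ *r _))
      rdotZl rdotZr.
    by rewrite -(hnorm_sq hdot) -/N2; set d := n.+1%:R^-1; lra.
  have c1 : 2 * t * (rd (e (y n)) (e x) - f x) + t ^+ 2 * N2 + n.+1%:R^-1
            @[n --> \oo] --> 2 * t * D + t ^+ 2 * N2 + 0.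
    apply: cvgD; last exact: cvg_harmonic.
    apply: cvgD; last exact: cvg_cst.
    apply: cvgM; first exact: cvg_cst.
    apply: cvgB; last exact: cvg_cst.
    exact: hcvg_rdot ys.
  rewrite -[leRHS]addr0; apply: (cvgr_to_ge c1); apply: nearW => n.
  by have := h n; rewrite -subr_ge0 opprK.
apply/eqP; rewrite -subr_eq0 -/D; apply/eqP.
have N20 : 0 <= N2 by rewrite sqr_ge0.
(* Nearly the minimizing [t]; the added 1 keeps the denominator positive when [e x = 0]. *)
have := key (- D / (N2 + 1)).
have n1 : 0 < N2 + 1 by lra.
move=> h; have {h} : 0 <= (2 * (- D / (N2 + 1)) * D + (- D / (N2 + 1)) ^+ 2 *
  N2) * (N2 + 1) ^+ 2.
  by rewrite mulr_ge0 // sqr_ge0.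
have -> : (2 * (- D / (N2 + 1)) * D + (- D / (N2 + 1)) ^+ 2 * N2) * (N2 + 1) ^+ 2
   = - (D ^+ 2 * (N2 + 2)) by field; rewrite gt_eqF.
move=> h; have D0 : D ^+ 2 = 0.
  by apply/eqP; rewrite eq_le sqr_ge0 andbT; have := sqr_ge0 D; nra.
by apply/eqP; rewrite -sqrf_eq0 D0.
Qed.

Lemma riesz_unique s s' (x x' : nat -> V) : hcvg (e \o x) s -> hcvg (e \o x') s' ->
  (forall z, rd s (e z) = rd s' (e z)) -> s = s'.
Proof.
move=> xs xs' h; apply/eqP; rewrite -subr_eq0; apply/eqP/(rdot_eq0 hdot).
have c := hcvg_rdot hdot (w := s - s') (hcvgB xs xs').
rewrite (_ : (fun n => _) = fun=> 0) in c.
  exact: (cvg_unique (@Rhausdorff R) c (cvg_cst 0)).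
apply/funext => n /=; rewrite rdotC rdotBr !rdotBl !h; lra.
Qed.

End Riesz.

(** * Maximal partial isometries in a space of operators *)

Section MaximalPartialIsometry.
Variables (R : realType) (H : completeNormedModType R[i]).
Variable dot : {dot H for Num.conj}.
Variables (M : set (H -> H)) (hM : star_algebra dot M).
Local Notation A := (opalg hM).
Local Notation rd := (rdot dot).
Implicit Types (x y z v w p q e : A) (u : H).

Let hdot := star_algebra_form hM.

Definition partial_isometry v := v * star v * v = v.

Lemma projection_pos p : projection p -> pos p.
Proof. by move=> [sp pp]; rewrite -pp; apply: pos_sq. Qed.

Lemma projectionC p : projection p -> projection (1 - p).
Proof.
move=> [sp pp]; split; first by rewrite starB star1 sp.
have -> : (1 - p) * (1 - p) = 1 - p - (p - p * p) by ncring.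
by rewrite pp subrr subr0.
Qed.

Lemma projection_unit_itv p : projection p -> unit_itv p.
Proof.
by move=> hp; split; [exact: projection_pos|apply/projection_pos/projectionC].
Qed.

Lemma pi_init v : partial_isometry v -> projection (star v * v).
Proof. by move=> hv; split; rewrite ?starM ?starK // -mulrA (mulrA v) hv. Qed.

Lemma pi_star v : partial_isometry v -> partial_isometry (star v).
Proof. by move=> hv;
  rewrite /partial_isometry starK -[in RHS]hv !starM starK mulrA. Qed.

Lemma pi_final v : partial_isometry v -> projection (v * star v).
Proof. by move=> /pi_star/pi_init; rewrite starK. Qed.

Lemma starM_projection_pi v : projection (star v * v) -> partial_isometry v.
Proof.
move=> [_ ee]; apply/eqP; rewrite -subr_eq0; apply/eqP/starM_eq0.
rewrite starB !starM starK.
have -> : (star v * (v * star v) - star v) * (v * star v * v - v) =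
  (star v * v - 1) * (star v * v * (star v * v) - star v * v) by ncring.
by rewrite ee subrr mulr0.
Qed.

(** Common ground for two cases: the corner [p A q], with [B] the centralizer of [q], and the
    eigenspace of a character, with [B] the fixed points. *)
Record corner_space (B X : set A) : Prop := CornerSpace {
  corner_lin : forall c x y, X x -> X y -> X (c *: x + y);
  corner_triple : forall x y z, X x -> X y -> X z -> X (x * star y * z);
  cornerMr : forall x b, X x -> B b -> X (x * b);
  corner_starM : forall x, X x -> B (star x * x);
  corner_lim : forall v (e : nat -> A) l, (forall n, B (e n)) -> B l ->
    monotone_unit e -> scvg e l -> (forall n, X (v * e n)) -> X (v * l);
  corner0 : X 0 }.

Variables (tr : A -> R) (B X : set A).
Hypotheses (htr : normal_trace tr) (hB : monotone_closed B) (hX : corner_space B X).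

Let cornerD x y : X x -> X y -> X (x + y).
Proof. by move=> Xx Xy; rewrite -[x]scale1r; apply: (corner_lin hX). Qed.

Let cornerB x y : X x -> X y -> X (x - y).
Proof. by move=> Xx Xy; rewrite addrC -scaleN1r; apply: (corner_lin hX). Qed.

(** The usual order on partial isometries: [w] restricts to [v] on the initial space of [v]. *)
Let extends v w := w * (star v * v) = v.

Lemma pi_extends_init v w : partial_isometry v -> partial_isometry w ->
  extends v w -> star w * w * (star v * v) = star v * v.
Proof.
move=> hv hw vw; have [sp pp] := pi_init hv; have [sq qq] := pi_init hw.
apply/eqP; rewrite -subr_eq0; apply/eqP/starM_eq0.
move: sp pp sq qq; set p := star v * v; set q := star w * w => sp pp sq qq.
rewrite starB starM sp sq.
have -> : (p * q - p) * (q * p - p) = p * (q * q) * p - p * q * p - p * q * p +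
  p * p by ncring.
have pqp : p * q * p = p.
  have -> : p * q * p = star (w * p) * (w * p) by rewrite starM sp /q; ncring.
  by rewrite vw.
by rewrite qq pqp pp subrr add0r addNr.
Qed.

(** Progress is measured by the trace of the initial projection. A nonzero element [x'] of the
    complementary corner contains a partial isometry orthogonal to [v] on both sides, and adding it
    to [v] increases that trace. *)
Lemma maximal_partial_isometry : exists v, [/\ X v, partial_isometry v &
  forall x, X x -> (1 - v * star v) * x * (1 - star v * v) = 0].
Proof.
pose P v := X v /\ partial_isometry v.
have ext_proj v w : P v -> P w -> extends v w ->
    projection (star w * w - star v * v).
  move=> [_ hv] [_ hw] vw; have qp := pi_extends_init hv hw vw.
  have [sp pp] := pi_init hv; have [sq qq] := pi_init hw.
  have pq : star v * v * (star w * w) = star v * v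
    by rewrite -sp -{1}sq -starM qp sp.
  split; first by rewrite starB sp sq.
  by rewrite mulrBl !mulrBr qq qp pq pp subrr subr0.
have P0 : P 0 by split; [exact: corner0 hX|rewrite /partial_isometry mulr0].
have ptr := normal_trace_pn htr.
have [|||||v [[Xv hv] _ vmax]] :=
  @maximal_element _ _ P extends (fun v => tr (star v * v)) _ _ _ _ _ 0 P0.
- by move=> v [_ hv]; rewrite /extends mulrA.
- move=> w v u [_ hv] [_ hw] _ vw wu; rewrite /extends.
  by rewrite -(pi_extends_init hv hw vw) mulrA wu vw.
- by move=> v w Pv Pw vw; apply: pn_le => //; apply/projection_pos/ext_proj.
- exists 1 => v [_ hv]; rewrite -(tr1 htr); apply: pn_le => //.
  exact/projection_pos/projectionC/pi_init.
(* Upper bound of a chain: the initial projections increase to [l], and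
   [x m - x n = x m (p m - p n)] for [n <= m] makes the partial isometries strongly Cauchy. *)
- move=> x Px xext; pose p n := star (x n) * x n.
  have hp n : projection (p n) by apply: pi_init; case: (Px n).
  have mp : monotone_unit p.
    by split=> n; [exact: projection_unit_itv|apply/projection_pos/ext_proj].
  have [l pl] := monotone_scvg mp.
  have Bl : B l by apply: (mclosed_lim hB _ mp pl) => n;
    apply: (corner_starM hX) => //; case: (Px n).
  have px n : partial_isometry (x n) by case: (Px n).
  have xE m n : (n <= m)%N -> x m * p n = x n.
    elim: m => [|m IH]; first by rewrite leqn0 => /eqP ->; rewrite /p mulrA px.
    rewrite leq_eqVlt => /orP[/eqP->|]; first by rewrite /p mulrA px.
    rewrite ltnS => nm; rewrite /p -(pi_extends_init (px n) (px m) (IH nm)) -/(p n).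
    by rewrite mulrA xext IH.
  have xc n u : hnorm (x n u) <= hnorm u.
    rewrite -(ler_pXn2r (ltn0Sn 1)) ?nnegrE ?hnorm_ge0 // -rdot_starM.
    have [_ /(_ u)] := (mp.1 n).2.
    by rewrite opaddE opoppE oponeE rdotBl -(hnorm_sq hdot) subr_ge0.
  have [v xv] : exists v, scvg x v.
    apply: (scvg_exists xc) => u; apply: hcauchy => eps eps0.
    have e2 : 0 < eps / 2 by rewrite divr_gt0.
    move/cvgrPdist_lt: (pl u) => /(_ _ e2) [N _ hN].
    exists N.
    have key m n : (N <= n)%N -> (n <= m)%N -> hnorm (x m u - x n u) < eps.
      move=> Nn nm; rewrite -(xE _ _ nm) -{1}(xE _ _ (leqnn m)) !opmulE -opB.
      apply: le_lt_trans (xc _ _) _.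
      have := hN n Nn; have := hN m (leq_trans Nn nm).
      rewrite /= !sub0r !normrN !ger0_norm ?hnorm_ge0 // => h1 h2.
      have := hnormD (p m u - l u) (- (p n u - l u)).
      by rewrite hnormN opprB addrA subrK; lra.
    move=> m n Nm Nn; have [mn|/ltnW nm] := leqP m n; last exact: key.
    by rewrite -opprB hnormN key.
  have vp n : v * p n = x n.
    apply: (@scvg_unique _ _ _ _ _ (fun m => x (m + n)%N * p n)).
      apply: scvgMr => u; rewrite /hcvg.
      by rewrite (cvg_shiftn n (fun m => hnorm (x m u - v u))); apply: xv.
    rewrite (_ : (fun m => _) = fun=> x n); first exact: scvg_const.
    by apply/funext => m; rewrite xE // leq_addl.
  have vl : v * l = v.
    apply: (@scvg_unique _ _ _ _ _ (fun n => v * p n)); first exact: scvgMl.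
    by rewrite (_ : (fun m => _) = x) //; apply/funext => n; apply: vp.
  (* The adjoint is not strongly continuous, so quadratic forms are compared instead. *)
  have svv : star v * v = l.
    have ul := scvg_unit_itv mp pl.
    apply/eqP; rewrite -subr_eq0; apply/eqP/pos_quad0.
      by rewrite starB starM starK ul.1.1.
    move=> u; rewrite opaddE opoppE rdotBl rdot_starM; apply/eqP;
      rewrite subr_eq0; apply/eqP.
    have c1 := hcvg_rdot hdot (w := u) (pl u).
    have c2 : hnorm (x n u) ^+ 2 @[n --> \oo] --> hnorm (v u) ^+ 2.
      by rewrite expr2; apply: cvgM; apply: hcvg_hnorm; apply: xv.
    rewrite (_ : (fun n => _) = (fun n => rd (p n u) u)) in c2; last first.
      by apply/funext => n; rewrite rdot_starM.
    exact: (cvg_unique (@Rhausdorff R) c2 c1).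
  exists v; last by move=> n; apply: vp.
  split; last by rewrite /partial_isometry -mulrA svv vl.
  rewrite -vl; apply: (corner_lim hX _ Bl mp pl) => n.
    by apply: (corner_starM hX) => //; case: (Px n).
  by rewrite vp; case: (Px n).
exists v; split=> // x Xx; apply: contrapT => /eqP; set x' := _ * x * _ => x'0.
have [sp pp] := pi_init hv; have [sq qq] := pi_final hv.
have Xx' : X x'.
  have -> : x' = x - v * star v * x - (x * star v * v - v * star v * x * star v * v).
    by rewrite /x'; ncring.
  have h1 : X (v * star v * x) by apply: (corner_triple hX).
  by apply: cornerB; apply: cornerB => //; apply: (corner_triple hX).
have a0 : star x' * x' != 0 by apply/eqP => /starM_eq0/eqP; apply/negP.
have [d [e [Bd Be [se ee] e0 [sd dad eE]]]] :=
  spectral_projection hB (corner_starM hX Xx') (pos_starM x') a0.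
(* A truncated polar decomposition: [d] inverts the absolute value of [x'] on the range of [e],
   which becomes the initial space of [w]. *)
pose w := x' * d; have Xw : X w by apply: (cornerMr hX).
have ww : star w * w = e by rewrite -dad /w starM sd; ncring.
have pw : partial_isometry w by apply: starM_projection_pi; rewrite ww.
have wE : w * e = w by rewrite -ww mulrA.
have ep : e * (star v * v) = 0.
  rewrite eE /x'; set p := star v * v in sp pp *.
  have -> : d * d * (star ((1 - v * star v) * x * (1 - p)) * ((1 - v * star v)
    * x * (1 - p))) * p
    = d * d * (star ((1 - v * star v) * x * (1 - p)) * ((1 - v * star v) * x *
      (p - p * p))) by ncring.
  by rewrite pp subrr !mulr0.
have pe : star v * v * e = 0 by rewrite -sp -se -starM ep star0.
have wp : w * (star v * v) = 0 by rewrite -wE -mulrA ep mulr0.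
have vw : star v * w = 0.
  rewrite -[star v](pi_star hv) starK /w /x'; set q := v * star v in sq qq *.
  have -> : star v * v * star v * ((1 - q) * x * (1 - star v * v) * d) =
    star v * ((q - q * q) * x * (1 - star v * v) * d) by rewrite /q; ncring.
  by rewrite qq subrr !mul0r mulr0.
have wv : star w * v = 0 by rewrite -[star w * v]starK starM starK vw star0.
have ve : v * e = 0 by rewrite -hv -!mulrA (mulrA _ v) pe mulr0.
have sE : star (v + w) * (v + w) = star v * v + e.
  by rewrite starD mulrDl !mulrDr vw wv ww addr0 add0r.
have Pvw : P (v + w).
  split; first exact: cornerD.
  by rewrite /partial_isometry -mulrA sE mulrDr !mulrDl mulrA hv wp ve wE add0r
    addr0.
have vvw : extends v (v + w) by rewrite /extends mulrDl wp addr0 mulrA.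
have := vmax _ Pvw vvw; rewrite sE (trD htr) => /eqP.
rewrite -subr_eq0 addrAC subrr add0r => /eqP h; move/eqP: e0; apply.
by apply: (tr_eq0 htr) h; apply: projection_pos.
Qed.

End MaximalPartialIsometry.

(** * Ideals and comparison of projections in a finite factor *)

Section Factor.
Variables (R : realType) (H : completeNormedModType R[i]).
Variable dot : {dot H for Num.conj}.
Variables (M : set (H -> H)) (hM : star_algebra dot M).
Local Notation A := (opalg hM).
Implicit Types (x y z v w p q e : A).
Variable tr : A -> R.
Hypothesis htr : normal_trace tr.

Record ideal (J : set A) : Prop := Ideal {
  idealD : forall x y, J x -> J y -> J (x + y);
  idealMl : forall a x, J x -> J (a * x);
  idealMr : forall x a, J x -> J (x * a) }.

Hypothesis center_trivial :
  forall x, (forall y, x * y = y * x) -> exists c : R[i], x = c *: 1.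

(* A maximal z in J with 0 <= z <= 1 is a two-sided unit of J, hence central. *)
Lemma closed_ideal (J : set A) : ideal J ->
  (forall (x : nat -> A) l, (forall n,
    J (x n)) -> monotone_unit x -> scvg x l -> J l) ->
  forall y, J y -> y <> 0 -> J 1.
Proof.
move=> [JD JMl JMr] Jlim y Jy y0; have ptr := normal_trace_pn htr.
pose P x := J x /\ unit_itv x; pose le x z := pos (z - x).
have P0 : P 0 by split; [rewrite -(mul0r y); apply: JMl|exact: unit_itv0].
have [|||||z [[Jz uz] _ zmax]] := @maximal_element _ _ P le tr _ _ _ _ _ 0 P0.
- by move=> x _; rewrite /le subrr; apply: pos0.
- by move=> u x w _ _ _ ux xw; rewrite /le -(subrK u w) -addrA; apply: posD.
- by move=> x w _ _; apply: pn_le.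
- by exists 1 => x [_ [_ ux]]; rewrite -(tr1 htr); apply: pn_le.
- move=> x Px lex; have mx : monotone_unit x by split=> // n; case: (Px n).
  have [l xl] := monotone_scvg mx; exists l; last by move=> n; apply: scvg_ge mx xl.
  split; last exact: scvg_unit_itv mx xl.
  by apply: (Jlim x) => // n; case: (Px n).
have uz' := unit_itvC uz.
(* Otherwise the element [h] of [J] could be added to [z] within the unit interval, against
   maximality. *)
have key x : J (star x * x) -> x * (1 - z) = 0.
  move=> Jx; have [k k0 [pk qk]] := pos_unit_itv (pos_starM x).
  set s := _ *: _ in pk qk; pose h := (1 - z) * s * (1 - z).
  have ph : pos h by apply: pos_conj_sa pk; exact: uz'.1.1.
  have Jh : J h.
    apply: (JMr); apply: (JMl); rewrite /s -[star x * x]mul1r scalerAl; exact: JMl.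
  have Pzh : P (z + h).
    split; [exact: JD|split; first exact: posD uz.1 ph].
    have -> : 1 - (z + h) = ((1 - z) - (1 - z) * (1 - z)) + (1 - z) * (1 - s) *
      (1 - z).
      by rewrite /h; ncring.
    by apply: posD; [exact: unit_itv_sq|apply: pos_conj_sa => //; exact: uz'.1.1].
  have := zmax _ Pzh; rewrite /le addrAC subrr add0r => /(_ ph).
  rewrite (trD htr) => /eqP; rewrite -subr_eq0 addrAC subrr add0r => /eqP h0.
  apply: starM_eq0; rewrite starM uz'.1.1.
  have := tr_eq0 htr ph h0; rewrite /h /s -scalerAr -scalerAl => /eqP.
  rewrite scaler_eq0 (fmorph_eq0 (real_complex R)) gt_eqF //= => /eqP <-.
  by ncring.
have unitr x : J x -> x * z = x.
  move=> Jx; have /eqP := key x (JMl _ _ Jx).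
  by rewrite mulrBr mulr1 subr_eq0 => /eqP.
have unitl x : J x -> z * x = x.
  move=> Jx; have := key (star x); rewrite starK => /(_ (JMr _ _ Jx)).
  move/(congr1 (@star _ _ _ _ _)); rewrite starM starK star0 uz'.1.1.
  by move/eqP; rewrite mulrBl mul1r subr_eq0 => /eqP.
have [x|c zE] := @center_trivial z.
  have zxz := unitl _ (JMl x _ Jz); rewrite -zxz mulrA.
  by rewrite (unitr _ (JMr _ x Jz)).
have := unitr y Jy; rewrite zE -scalerAr mulr1 => cy.
have c1 : c = 1.
  apply/eqP; rewrite -subr_eq0; have /eqP : (c - 1) *: y = 0.
    by rewrite scalerBl cy scale1r subrr.
  by rewrite scaler_eq0 => /orP[//|/eqP].
by move: Jz; rewrite zE c1 scale1r.
Qed.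

(** The elements [y] with [y x b = 0] for all [x] form an ideal closed under strong limits, so
    [closed_ideal] applies. Primeness thus precedes simplicity, which concerns arbitrary ideals. *)
Lemma factor_prime a b : (forall x, a * x * b = 0) -> a <> 0 -> b = 0 :> A.
Proof.
move=> ab a0; pose J : set A := [set y | forall x, y * x * b = 0].
suff J1 : J 1 by rewrite -[b]mul1r -[1](mulr1 1); apply: J1.
apply: (@closed_ideal J _ _ a) => //.
  split=> [x y Jx Jy z|c x Jx z|x c Jx z].
  - by rewrite !mulrDl Jx Jy addr0.
  - by rewrite -!mulrA [x * _]mulrA Jx mulr0.
  - by rewrite -(mulrA x) Jx.
move=> x l Jx _ xl y; apply: (@scvg_unique _ _ _ _ _ (fun n => x n * y * b)).
  by do 2!apply: scvgMr.
by rewrite (_ : (fun n => _) = fun=> 0); [exact: scvg_const|apply/funext => n;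
  apply: Jx].
Qed.

Lemma corner_space_projections p q : projection p -> projection q ->
  corner_space (centralizer [set q]) [set x | p * x * q = x].
Proof.
move=> [sp pp] [sq qq].
have px x : p * x * q = x -> p * x = x by move=> h; rewrite -{2}h -{1}h !mulrA pp.
have xq x : p * x * q = x -> x * q = x by move=> h; rewrite -{2}h -{1}h -!mulrA qq.
split=> /=.
- by move=> c x y hx hy; rewrite mulrDr mulrDl -scalerAr -scalerAl hx hy.
- by move=> x y z hx _ hz; rewrite !mulrA px // -!mulrA xq.
- by move=> x b hx hb; rewrite mulrA px // -mulrA hb // mulrA xq.
- move=> x hx y ->; rewrite -mulrA xq // mulrA; congr (_ * _).
  by rewrite -[in LHS](xq x hx) starM sq.
- move=> v e l _ _ _ el hv;
  apply: (@scvg_unique _ _ _ _ _ (fun n => p * (v * e n) * q)).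
    by apply/scvgMr/scvgMl/scvgMl.
  by rewrite (_ : (fun n => _) = (fun n => v * e n));
    [exact: scvgMl|apply/funext => n; apply: hv].
- by rewrite mulr0 mul0r.
Qed.

(** A maximal partial isometry in [p A q] leaves defects [p - v (star v)] and [q - (star v) v] with
    only 0 between them, and primeness kills one of the two. *)
Lemma comparison p q : projection p -> projection q ->
  exists v, [/\ partial_isometry v,
    p * v * q = v & v * star v = p \/ star v * v = q].
Proof.
move=> hp hq; have hC := corner_space_projections hp hq.
have hB : monotone_closed (centralizer [set q]).
  by apply: mclosed_centralizer => y ->; apply: hq.1.
have [v [/= Xv pv vmax]] := maximal_partial_isometry htr hB hC.
move: hp hq => [sp pp] [sq qq].
have vq : v * q = v by rewrite -[in LHS]Xv -mulrA qq Xv.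
have pv' : p * v = v by rewrite -[in LHS]Xv !mulrA pp Xv.
have qv : star v * v * q = star v * v by rewrite -mulrA vq.
have svp : star v * p = star v by rewrite -[in LHS]sp -starM pv'.
have vp : v * star v * p = v * star v by rewrite -mulrA svp.
exists v; split=> //.
have [|n0] := pselect (p - v * star v = 0).
  by move/eqP; rewrite subr_eq0 => /eqP ->; left.
right; suff : q - star v * v = 0 by move/eqP; rewrite subr_eq0 => /eqP.
apply: factor_prime n0 => x.
have Xpxq : p * (p * x * q) * q = p * x * q by rewrite !mulrA pp -mulrA qq.
rewrite -[RHS](vmax _ Xpxq).
have qv' : q * (star v * v) = star v * v.
  by rewrite -sq -{1}[star v * v](pi_init pv).1 -starM qv (pi_init pv).1.
by rewrite -[in LHS]vp -[in LHS]qv'; ncring.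
Qed.

(* If e is a nonzero projection of J, then comparing 1 - f with e enlarges any
   projection f of J by a copy of e, until 1 - f is dominated by e. *)
Lemma factor_simple (J : set A) : ideal J -> forall x, J x -> x <> 0 -> J 1.
Proof.
move=> [JD JMl JMr] x Jx x0.
have a0 : star x * x != 0 by apply/eqP => /starM_eq0.
have [d [e [_ _ he e0 [_ _ eE]]]] :=
  spectral_projection (mclosedT hM) (I : setT (star x * x)) (pos_starM x) a0.
have Je : J e by rewrite eE; apply/JMl/JMl.
have t0 : 0 < tr e.
  rewrite lt_neqAle tr_ge0 // ?andbT; last exact: projection_pos.
  by rewrite eq_sym; apply/eqP => /(tr_eq0 htr (projection_pos he))/eqP; apply/negP.
(* Since [tr f <= 1], the second alternative fails for large [n]. *)
have grow n : J 1 \/ exists f, [/\ J f, projection f & n%:R * tr e <= tr f].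
  elim: n => [|n [|[f [Jf hf nf]]]]; [|by left|].
    right; exists 0; split; first by rewrite -(mul0r x); apply: JMl.
      by split; rewrite ?star0 ?mulr0.
    by rewrite mul0r; apply: tr_ge0 => //; apply: pos0.
  have [v [pv vE [vv|vv]]] := comparison (projectionC hf) he.
    left; rewrite -(subrK f 1); apply: JD => //; rewrite -vv -vE; apply/JMr.
    exact: JMl.
  right; exists (f + v * star v).
  have fv : f * v = 0 by rewrite -vE !mulrA mulrBr mulr1 hf.2 subrr !mul0r.
  split.
  - by apply: JD => //; rewrite -vE; apply/JMr/JMl.
  - split; first by rewrite starD starM starK hf.1.
    have vf : star v * f = 0 by rewrite -hf.1 -starM fv star0.
    rewrite mulrDr !mulrDl hf.2 [f * _]mulrA fv mul0r -(mulrA v (star v) f) vf mulr0.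
    by rewrite addr0 add0r (pi_final pv).2.
  - by rewrite (trD htr) [in tr (v * _)](trC htr) vv -addn1 natrD mulrDl mul1r lerD.
have [n] := ltr_add_invr t0; rewrite add0r => hn.
have [//|[f [_ hf]]] := grow n.+1.
have : tr f <= 1 by rewrite -(tr1 htr); apply: pn_le (normal_trace_pn htr) _;
  apply/projection_pos/projectionC.
move=> f1 /le_trans/(_ f1); rewrite leNgt => /negP[].
by rewrite mulrC -ltr_pdivrMr ?ltr0Sn // mul1r.
Qed.

End Factor.

(** The polynomial [X^n - 1] splits and is separable in characteristic 0; its [n] distinct roots
    must include a primitive one. *)
Lemma prim_root_exists (C : numClosedFieldType) n : (0 < n)%N ->
  exists z : C, n.-primitive_root z.
Proof.
pose p : {poly C} := 'X^n - 1; have [r Dp] := closed_field_poly_normal p.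
move=> n_gt0; rewrite (monicP _) ?monicXnsubC // scale1r in Dp.
have rn1 : all n.-unity_root r by apply/allP=> z; rewrite -root_prod_XsubC -Dp.
have sz_r : (n < (size r).+1)%N.
  by rewrite -(size_prod_XsubC r id) -Dp size_XnsubC.
have [|z] := hasP (cyclic.has_prim_root n_gt0 rn1 _ sz_r); last by exists z.
rewrite -separable.separable_prod_XsubC -Dp cyclotomic.separable_Xn_sub_1 //.
by rewrite pnatr_eq0 -lt0n.
Qed.

(** * Outer actions: independence, relative commutant, eigenspaces *)

Section OuterAction.
Variables (R : realType) (H : completeNormedModType R[i]).
Variable dot : {dot H for Num.conj}.
Variables (M : set (H -> H)) (hM : star_algebra dot M).
Local Notation A := (opalg hM).
Local Notation "a *r x" := (a%:C%C *: x) (at level 40).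
Implicit Types (a b x y z u v w : A).
Variable tr : A -> R.
Hypothesis htr : normal_trace tr.
Hypothesis center_trivial :
  forall x, (forall y, x * y = y * x) -> exists c : R[i], x = c *: 1.
Variables (gT : finGroupType) (G : {group gT}) (act : gT -> A -> A).
Hypothesis actP : forall g, g \in G -> star_auto (act g).
Hypothesis actM : forall g h, g \in G -> h \in G ->
  forall x, act (g * h)%g x = act g (act h x).
Hypothesis act_outer : forall g, g \in G -> g != 1%g -> forall u,
  star u * u = 1 -> u * star u = 1 -> ~ (forall x, act g x = u * x * star u).

Lemma act1 x : act 1%g x = x.
Proof.
have [h hK _] := auto_bij (actP (group1 G)).
by apply: (can_inj hK); rewrite -actM ?group1 // mulg1.
Qed.

Lemma actK g : g \in G -> cancel (act g) (act g^-1%g).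
Proof. by move=> gG x; rewrite -actM ?groupV // mulVg act1. Qed.

Lemma actVK g : g \in G -> cancel (act g^-1%g) (act g).
Proof. by move=> gG x; rewrite -actM ?groupV // mulgV act1. Qed.

Lemma scalar_op_inj (c d : R[i]) x : x <> 0 -> c *: x = d *: x -> c = d.
Proof.
move=> x0 /eqP; rewrite -subr_eq0 -scalerBl scaler_eq0 subr_eq0.
by move=> /orP[/eqP//|/eqP].
Qed.

Lemma one_neq0 : (1 : A) <> 0.
Proof. exact/eqP/oner_neq0. Qed.

(** Both [a (star a)] and [(star a) a] are central, hence the same scalar [c]. If [a] were not 0,
    then [c > 0] and [star a] divided by the root of [c] would be a unitary implementing [act g]. *)
Lemma outer_intertwiner g a : g \in G -> g != 1%g ->
  (forall z, z * a = a * act g z) -> a = 0.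
Proof.
move=> gG g1 ha; apply: contrapT => a0; have hg := actP gG.
have sa z : act g z * star a = star a * z.
  by rewrite -[act g z]starK -auto_star // -starM -ha starM starK.
have [y|c aaE] := @center_trivial (a * star a).
  by rewrite -mulrA -sa mulrA -ha mulrA.
have [y|d sE] := @center_trivial (star a * a).
  by rewrite -(actVK gG y) mulrA sa -!mulrA -ha.
have cd : c = d.
  apply: (scalar_op_inj a0).
  by rewrite -[a in LHS]mul1r scalerAl -aaE -mulrA sE -scalerAr mulr1.
have cr : c = (Re c)%:C%C.
  have : star (a * star a) = a * star a by rewrite starM starK.
  rewrite aaE starZ star1 => /(scalar_op_inj one_neq0).
  by case: (c) => x y [] yN; have -> : y = 0 by lra.
have c0 : 0 < Re c.
  have [v v0] := exists_neq0 hM.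
  have := pos_starM (star a); rewrite starK => -[_ /(_ v)].
  rewrite aaE cr opE oponeE rdotZl -(hnorm_sq (star_algebra_form hM)).
  rewrite pmulr_lge0 ?exprn_gt0 ?hnorm_gt0 // le_eqVlt => /orP[/eqP c0|//].
  by case: a0; apply: starM_eq0; rewrite sE -cd cr -c0 scale0r.
pose k := (Num.sqrt (Re c))^-1.
have kk : k%:C%C * k%:C%C * c = 1.
  rewrite cr -!rmorphM /k -invfM -expr2 sqr_sqrtr ?ltW // mulVf ?gt_eqF //.
have sk : star (k *r star a) = k *r a by rewrite star_rZ starK.
apply: (act_outer gG g1 (u := k *r star a)); rewrite ?sk.
- by rewrite -scalerAl -scalerAr aaE !scalerA kk scale1r.
- by rewrite -scalerAl -scalerAr sE -cd !scalerA kk scale1r.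
- move=> x; rewrite -!scalerAl -scalerAr -mulrA ha mulrA sE -cd.
  by rewrite -scalerAl mul1r !scalerA kk scale1r.
Qed.

(** A function [f] stands for the element of the direct sum with component [f g] in [M_g]; only its
    values on [G] matter. *)
Record subbimodule (W : set (gT -> A)) : Prop := Subbimodule {
  subbimoduleB : forall f h, W f -> W h -> W (fun g => f g - h g);
  subbimoduleMl : forall y f, W f -> W (fun g => y * f g);
  subbimoduleMr : forall f y, W f -> W (fun g => f g * act g y) }.

(* The twisted bimodules M_g are simple and pairwise non-isomorphic, so a
   subbimodule of their direct sum is the sum of the M_g that it meets. *)
Lemma subbimodule_delta (W : set (gT -> A)) : subbimodule W ->
  forall f h, W f -> h \in G -> f h <> 0 ->
  exists f', [/\ W f', f' h = 1 & forall g, g \in G -> g != h -> f' g = 0].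
Proof.
move=> [WB Wl Wr] f; pose supp (f : gT -> A) := [set g in G | f g != 0].
have [n] := ubnP #|supp f|; elim: n f => // n IH f; rewrite ltnS => fn h Wf hG fh.
have suppP (f' : gT -> A) g : g \in G -> g \notin supp f' -> f' g = 0.
  by move=> gG; rewrite inE gG /= negbK => /eqP.
(* The components at [h] of the elements of [W] supported in [supp f] form a nonzero ideal, so
   simplicity normalizes one of them to 1. *)
have [a [Wa af ah]] : exists a : gT -> A, [/\ W a, supp a \subset supp f & a h = 1].
  pose J : set A := [set x | exists a : gT -> A, [/\ W a,
    supp a \subset supp f & a h = x]].
  have hJ : ideal J.
    split.
    - move=> x y [a [Wa af <-]] [b [Wb bf <-]]; exists (fun g => a g - (-1) * b g).
      split; [by apply: WB => //; apply: Wl| |by rewrite mulN1r opprK].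
      apply/fintype.subsetP => g; rewrite !inE => /andP[gG]; apply: contraR.
      rewrite gG /= => fg.
      have gf : g \notin supp f by rewrite inE gG.
      rewrite (suppP a) ?(suppP b) ?mulr0 ?subr0 //;
        by apply: contra gf => /(fintype.subsetP _); apply.
    - move=> c x [a [Wa af <-]]; exists (fun g => c * a g); split=> //;
      first exact: Wl.
      apply: fintype.subset_trans af; apply/fintype.subsetP => g.
      by rewrite !inE => /andP[->]; apply: contra => /eqP->; rewrite mulr0.
    - move=> x c [a [Wa af <-]]; exists (fun g => a g * act g (act h^-1%g c)).
      split; [exact: Wr| |by rewrite actVK].
      apply: fintype.subset_trans af; apply/fintype.subsetP => g.
      by rewrite !inE => /andP[->]; apply: contra => /eqP->; rewrite mul0r.
  have [] // := factor_simple htr center_trivial hJ (x := f h).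
    by exists f.
  by move=> a [? ? ?]; exists a.
have ha : h \in supp a by rewrite inE hG ah oner_neq0.
(* If all these commutators vanish, each [a g] intertwines [act (g * h^-1)] and is 0 for [g] other
   than [h]. Otherwise a commutator [b] has smaller support, because it vanishes at [h]. *)
have [all0|] := pselect (forall z g, g \in G -> act h z * a g = a g * act g z).
  exists a; split=> // g gG gh; apply: (@outer_intertwiner (g * h^-1)%g).
  - by rewrite groupM ?groupV.
  - by rewrite -eq_mulgV1.
  - by move=> z; rewrite actM ?groupV // -all0 // actVK.
move=> /existsNP[z /existsNP[k /not_implyP[kG /eqP]]]; rewrite -subr_eq0 => /eqP bk.
pose b g := act h z * a g - a g * act g z.
have Wb : W b by apply: WB; [exact: Wl|exact: Wr].
have ba : supp b \subset supp a :\ h.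
  apply/fintype.subsetP => g; rewrite !inE => /andP[gG]; rewrite gG /b => bg.
  apply/andP; split; first by apply: contra bg => /eqP->;
    rewrite ah mulr1 mul1r subrr.
  by apply: contra bg => /eqP->; rewrite mulr0 mul0r subrr.
have ca : (#|supp a :\ h| < #|supp a|)%N by rewrite (cardsD1 h (supp a)) ha.
have afn := leq_trans (subset_leq_card af) fn.
have [|d [Wd dk d0]] := IH b _ k Wb kG bk.
  exact: leq_ltn_trans (subset_leq_card ba) (leq_trans ca afn).
have kb : k \in supp b by rewrite inE kG; apply/eqP.
have /[!inE]/and3P[kh _ ak] := fintype.subsetP ba k kb.
(* Induction applied to [b] gave [d], concentrated at [k]; subtracting it removes [k] from the
   support and keeps the component 1 at [h]. *)
pose c g := a g - a k * d g.
have Wc : W c by apply: WB => //; apply: Wl.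
have cc : supp c \subset supp a :\ k.
  apply/fintype.subsetP => g; rewrite !inE => /andP[gG]; rewrite gG /c.
  have [->|gk] := eqVneq g k; first by rewrite dk mulr1 subrr eqxx.
  by rewrite d0 // mulr0 subr0.
have ka : k \in supp a by rewrite inE kG.
have ch : c h <> 0.
  by rewrite /c d0 1?eq_sym // mulr0 subr0 ah; apply: one_neq0.
apply: (IH c) => //; apply: leq_ltn_trans (subset_leq_card cc) (leq_trans _ afn).
by rewrite (cardsD1 k (supp a)) ka.
Qed.

(** An analogue of Dedekind's independence: the annihilating families form a subbimodule, and one
    concentrated at a single [h] would force [y = 0]. The factor [y] makes room for the defect
    projection in [eigenspace_unitary]. *)
Lemma act_independent (f : gT -> A) y : y <> 0 ->
  (forall x, \sum_(g in G) f g * act g x * y = 0) -> forall h, h \in G -> f h = 0.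
Proof.
move=> y0 f0 h hG; apply: contrapT => fh.
pose W := [set f : gT -> A | forall x, \sum_(g in G) f g * act g x * y = 0].
have hW : subbimodule W.
  split=> [f1 f2 h1 h2 x|z f1 h1 x|f1 z h1 x].
  - rewrite (eq_bigr (fun g => f1 g * act g x * y - f2 g * act g x * y)).
      by rewrite sumrB h1 h2 subrr.
    by move=> g _; rewrite !mulrBl.
  - rewrite (eq_bigr (fun g => z * (f1 g * act g x * y))).
      by rewrite -mulr_sumr h1 mulr0.
    by move=> g _; rewrite !mulrA.
  - rewrite (eq_bigr (fun g => f1 g * act g (z * x) * y)) ?h1 //.
    by move=> g gG; rewrite autoM ?mulrA //; apply: actP.
have [f' [Wf' f'h f'0]] := subbimodule_delta hW f0 hG fh.
apply: y0; have := Wf' 1; rewrite (bigD1 h) //= big1 ?addr0.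
  by rewrite f'h (auto1 (actP hG)) !mul1r.
by move=> g /andP[gG gh]; rewrite f'0 // !mul0r.
Qed.

Definition fixed (S : {set gT}) : set A :=
  [set x | forall g, g \in S -> act g x = x].

Lemma mclosed_fixed (S : {set gT}) : S \subset G -> monotone_closed (fixed S).
Proof.
move=> /fintype.subsetP SG.
have -> : fixed S = fixed_by (fun i : {g | g \in S} => act (sval i)).
  apply/seteqP; split=> x hx; first by move=> [g gS]; apply: hx.
  by move=> g gS; apply: (hx (exist _ g gS)).
by apply: mclosed_fixed_by => -[g gS]; apply/actP/SG.
Qed.

Lemma act_sum_fixed x : fixed G (\sum_(g in G) act g x).
Proof.
move=> h hG; rewrite (auto_sum _ _ _ (actP hG)).
rewrite (reindex_inj (mulgI h^-1%g)) /=.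
apply: eq_big => [g|g]; first by rewrite groupMl ?groupV.
by rewrite groupMl ?groupV // => gG; rewrite -actM ?groupM ?groupV // mulKVg.
Qed.

(** A Galois basis writes [y] as the sum of [a_i E(b_i y)], with [E] the sum over the orbit. Since
    [x] commutes with values of [E], [y x] becomes the sum of the [c g * act g y]; by independence
    each [c g] is an intertwiner, so only the scalar [c 1] survives. *)
Lemma relative_commutant_trivial x :
  (forall y, fixed G y -> x * y = y * x) -> exists c : R[i], x = c *: 1.
Proof.
move=> xN.
(* The subbimodule generated by the element all of whose components are 1. *)
pose W := [set f : gT -> A | exists s : seq (A * A),
  forall g, g \in G -> f g = \sum_(p <- s) p.1 * act g p.2].
have hW : subbimodule W.
  split=> [f1 f2 [s1 h1] [s2 h2]|z f1 [s h1]|f1 z [s h1]].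
  - exists (s1 ++ [seq (- p.1, p.2) | p <- s2]) => g gG.
    rewrite h1 // h2 // big_cat big_map /=; congr (_ + _).
    by rewrite -sumrN; apply: eq_bigr => p _; rewrite mulNr.
  - exists [seq (z * p.1, p.2) | p <- s] => g gG.
    by rewrite h1 // big_map mulr_sumr; apply: eq_bigr => p _; rewrite mulrA.
  - exists [seq (p.1, p.2 * z) | p <- s] => g gG.
    rewrite h1 // big_map mulr_suml; apply: eq_bigr => p _ /=.
    by rewrite autoM ?mulrA //; apply: actP.
have W1 : W (fun=> 1).
  exists [:: (1, 1)] => g gG; rewrite big_seq1 /= mul1r auto1 //; exact: actP.
(* A Galois basis: sum of a_i act_g(b_i) is 1 for g = 1 and 0 otherwise. *)
have [f [[s hs] f1 f0]] := subbimodule_delta hW W1 (group1 G) one_neq0.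
pose E y := \sum_(g in G) act g y.
have sE y : \sum_(p <- s) p.1 * E (p.2 * y) = y.
  rewrite (eq_bigr (fun p => \sum_(g in G) p.1 * act g p.2 * act g y)); last first.
    move=> p _; rewrite mulr_sumr; apply: eq_bigr => g gG.
    by rewrite autoM ?mulrA //; apply: actP.
  rewrite exchange_big (bigD1 1%g) //= [X in _ + X]big1 ?addr0.
    by rewrite -mulr_suml -hs // f1 act1 mul1r.
  by move=> g /andP[gG g1]; rewrite -mulr_suml -hs // f0 // mul0r.
pose c g := \sum_(p <- s) p.1 * x * act g p.2.
have cE y : \sum_(g in G) c g * act g y = y * x.
  rewrite -[in RHS](sE y) mulr_suml.
  transitivity (\sum_(p <- s) p.1 * x * E (p.2 * y)).
    rewrite (eq_bigr (fun p => \sum_(g in G) p.1 * x * act g p.2 * act g y)).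
      by rewrite exchange_big; apply: eq_bigr => g _; rewrite mulr_suml.
    move=> p _; rewrite mulr_sumr; apply: eq_bigr => g gG.
    by rewrite autoM ?mulrA //; apply: actP.
  by apply: eq_bigr => p _; rewrite -!mulrA xN //; apply: act_sum_fixed.
have cz z g : g \in G -> z * c g = c g * act g z.
  move=> gG; apply/eqP; rewrite -subr_eq0; apply/eqP; move: g gG.
  apply: (act_independent one_neq0) => y.
  rewrite (eq_bigr (fun g => z * (c g * act g y) - c g * act g (z * y))).
    by rewrite sumrB -mulr_sumr !cE mulrA subrr.
  by move=> g gG; rewrite mulr1 mulrBl (autoM (actP gG)) !mulrA.
have [y|k kE] := @center_trivial (c 1%g); first by rewrite cz // act1.
exists k; have := cE 1; rewrite (bigD1 1%g) //= big1 ?addr0.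
  by rewrite act1 mulr1 mul1r kE.
by move=> g /andP[gG g1]; rewrite (@outer_intertwiner g (c g)) ?mul0r // => z;
  apply: cz.
Qed.

(** * Unitaries in the eigenspace of a character *)

Section Eigenspace.
Variable chi : gT -> R[i].
Hypothesis chiM : forall g h, g \in G -> h \in G -> chi (g * h)%g = chi g * chi h.
Hypothesis chi_unit : forall g, g \in G -> (chi g)^*%C * chi g = 1.

Definition eigenspace_of : set A :=
  [set x | forall g, g \in G -> act g x = chi g *: x].

Let chi1 : chi 1%g = 1.
Proof.
have c0 : chi 1%g != 0.
  by apply/eqP => c0; have /eqP := chi_unit (group1 G);
    rewrite c0 mulr0 eq_sym oner_eq0.
by apply: (mulfI c0); rewrite -chiM ?group1 // mulg1 mulr1.
Qed.

Lemma corner_eigenspace : corner_space (fixed G) eigenspace_of.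
Proof.
have sX x g : g \in G -> eigenspace_of x -> act g (star x) = (chi g)^*%C *: star x.
  by move=> gG hx; rewrite auto_star ?hx ?starZ //; apply: actP.
split.
- move=> c x y hx hy g gG; rewrite (auto_lin (actP gG)) hx // hy // scalerDr.
  by rewrite !scalerA mulrC.
- move=> x y z hx hy hz g gG; rewrite !(autoM (actP gG)) hx // hz // sX //.
  by rewrite -!scalerAl -!scalerAr -scalerAl !scalerA mulrAC -mulrA chi_unit ?mulr1.
- by move=> x b hx hb g gG; rewrite (autoM (actP gG)) hx // hb // scalerAl.
- move=> x hx g gG; rewrite (autoM (actP gG)) hx // sX //.
  by rewrite -scalerAl -scalerAr scalerA chi_unit // scale1r.
- move=> v e l he hl me el hv g gG; rewrite (autoM (actP gG)) hl //.
  apply: (@scvg_unique _ _ _ _ _ (fun n => act g v * e n)); first exact: scvgMl.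
  rewrite (_ : (fun n => _) = (fun n => chi g *: (v * e n))).
    by apply/scvgZ/scvgMl.
  by apply/funext => n; rewrite -hv // (autoM (actP gG)) he.
- by move=> g gG; rewrite (auto0 (actP gG)) scaler0.
Qed.

Lemma eigenspace_average x :
  eigenspace_of (\sum_(g in G) (chi g)^*%C *: act g x).
Proof.
move=> h hG; rewrite (auto_sum _ _ _ (actP hG)) scaler_sumr.
rewrite [RHS](reindex_inj (mulgI h)) /=.
apply: eq_big => [g|g gG]; first by rewrite groupMl.
rewrite (autoZ _ _ (actP hG)) -actM // scalerA chiM // rmorphM /= mulrA.
by rewrite [chi h * _]mulrC chi_unit // mul1r.
Qed.

(** Maximality of [v], applied to the averages of all [x], is a relation between the [act g] with a
    defect projection on each side. By independence one defect vanishes; the two have equal trace,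
    so both do. *)
Lemma eigenspace_unitary :
  exists u, [/\ eigenspace_of u, star u * u = 1 & u * star u = 1].
Proof.
have hC := corner_eigenspace.
have [v [Xv pv vmax]] :=
  maximal_partial_isometry htr (mclosed_fixed (fintype.subxx G)) hC.
have hp := pi_init pv; have hq := pi_final pv.
have Np : fixed G (star v * v) := corner_starM hC Xv.
have tpq : tr (1 - star v * v) = tr (1 - v * star v).
  by rewrite !(pnB _ _ (normal_trace_pn htr)) (trC htr v).
have eq1 p : projection p -> tr (1 - p) = 0 -> p = 1.
  move=> /projectionC/projection_pos pos1p /(tr_eq0 htr pos1p)/eqP.
  by rewrite subr_eq0 => /eqP.
suff [p1|q1] : star v * v = 1 \/ v * star v = 1.
- exists v; split=> //; apply: eq1 => //.
  by rewrite -tpq p1 subrr -[0](subrr 1) (pnB _ _ (normal_trace_pn htr)) subrr.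
- exists v; split=> //; apply: eq1 => //.
  by rewrite tpq q1 subrr -[0](subrr 1) (pnB _ _ (normal_trace_pn htr)) subrr.
have [|p1] := pselect (1 - star v * v = 0).
  by move/eqP; rewrite subr_eq0 => /eqP ->; left.
right; suff : (chi 1%g)^*%C *: (1 - v * star v) = 0.
  by rewrite chi1 conjc1 scale1r => /eqP; rewrite subr_eq0 => /eqP ->.
apply: (act_independent (f :=
  fun g => (chi g)^*%C *: (1 - v * star v)) p1 _ (group1 G)) => x.
rewrite -[RHS](vmax _ (eigenspace_average x)) mulr_sumr mulr_suml.
by apply: eq_bigr => g gG; rewrite -scalerAl -scalerAr.
Qed.

End Eigenspace.

Let K := [~: G, G]%G.

Lemma act_fixed_derived g x : g \in G -> fixed K x -> fixed K (act g x).
Proof.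
move=> gG hx k kK; have kG : k \in G := fintype.subsetP (der1_subG G) k kK.
have kgK : (k ^ g)%g \in K.
  by rewrite memJ_norm //; apply: (fintype.subsetP (normsR (normG G) (normG G))).
by rewrite -actM // conjgC actM ?groupJ // hx.
Qed.

Lemma act_comm_derived g h x : g \in G -> h \in G -> fixed K x ->
  act h (act g x) = act g (act h x).
Proof.
move=> gG hG hx; rewrite -!actM // commgC (actM (groupM gG hG) (groupR hG gG)).
by rewrite (hx [~ h, g]%g (mem_commg hG gG)).
Qed.

(** On [fixed K] the operators [act g] commute and have finite order, so they are simultaneously
    diagonalizable. The eigenvector condition is acquired for one group element at a time. *)
Lemma eigenvector_ind (P : set A) : P 0 -> (forall x y, P x -> P y -> P (x + y)) ->
  (forall y, fixed K y -> (forall g, g \in G -> exists c : R[i],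
    act g y = c *: y) -> P y) ->
  forall x, fixed K x -> P x.
Proof.
move=> P0 PD PE.
suff main (s : seq gT) : (forall g, g \in s -> g \in G) ->
    (forall y, fixed K y -> (forall g, g \in s -> exists c : R[i],
      act g y = c *: y) -> P y) ->
    forall x, fixed K x -> P x.
  apply: (main (enum G)) => [g|y Ky hy]; first by rewrite mem_enum.
  by apply: PE => // g gG; apply: hy; rewrite mem_enum.
elim: s => [|g s IH] sG hE x Kx; first exact: hE.
have gG : g \in G by apply: sG; rewrite inE eqxx.
apply: IH x Kx => [h hs|y Ky hy]; first by apply: sG; rewrite inE hs orbT.
pose n := #[g]%g; have n0 : (0 < n)%N by apply: order_gt0.
have [w pw] := prim_root_exists R[i] n0; pose o := w^-1.
have on : o ^+ n = 1 by rewrite /o exprVn (prim_expr_order pw) invr1.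
have o0 : o != 0.
  by apply/eqP => o0; move: on; rewrite o0 expr0n gtn_eqF //= => /esym/eqP;
    rewrite oner_eq0.
pose F j k := o ^+ (j * k) *: act (g ^+ k)%g y.
pose z j := n%:R^-1 *: \sum_(k < n) F j k.
have gk k : (g ^+ k)%g \in G by apply: groupX.
have hK : monotone_closed (fixed K) by apply: mclosed_fixed; apply: der1_subG.
have Kz j : fixed K (z j).
  apply: (mclosedZ _ hK); elim/big_ind: _ => [|x1 x2|k _];
    [exact: mclosed0|exact: mclosedD|].
  by apply: (mclosedZ _ hK); apply: act_fixed_derived.
have nR : n%:R != 0 :> R[i] by rewrite pnatr_eq0 -lt0n.
(* z j is the component of y for the eigenvalue o^-j of act g. *)
have yE : y = \sum_(j < n) z j.
  rewrite -scaler_sumr exchange_big /=.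
  rewrite (bigD1 (Ordinal n0)) //= [X in _ + X]big1 ?addr0; last first.
    move=> k k0; rewrite -scaler_suml.
    rewrite (eq_bigr (fun j : 'I_n => (o ^+ k) ^+ j)); last by move=> j _;
      rewrite -exprM mulnC.
    have ok : o ^+ k - 1 != 0.
      rewrite subr_eq0 /o exprVn invr_eq1 -(prim_order_dvd pw) gtnNdvd //.
      by rewrite lt0n; apply: contra k0 => /eqP k0; apply/eqP/val_inj.
    have /eqP := subrX1 (o ^+ k) n;
      rewrite -exprM mulnC exprM on expr1n subrr eq_sym.
    by rewrite mulf_eq0 (negPf ok) => /eqP ->; rewrite scale0r.
  rewrite (eq_bigr (fun=> y)); last by move=> j _;
    rewrite /F muln0 expr0 expg0 act1 scale1r.
  rewrite sumr_const card_ord -[y *+ n](scaler_nat (R := R[i]) n y) scalerA.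
  by rewrite mulVf // scale1r.
have gz j : exists c : R[i], act g (z j) = c *: z j.
  exists (o ^+ j)^-1; apply: (scalerI (expf_neq0 j o0)).
  rewrite scalerA divff ?expf_neq0 // scale1r (autoZ _ _ (actP gG)) scalerA
    mulrC -scalerA.
  congr (_ *: _); rewrite (auto_sum _ _ _ (actP gG)) scaler_sumr.
  transitivity (\sum_(k < n) F j k.+1).
    apply: eq_bigr => k _; rewrite (autoZ _ _ (actP gG)) -actM // -expgS scalerA.
    by rewrite /F mulnS exprD.
  (* The shifted sum wraps around: [F j n = F j 0], because the [n]-th powers of [o] and of [g] are
     trivial. *)
  apply: (addrI (F j 0%N));
    rewrite -(big_ord_recl n (fun k => F j k)) big_ord_recr addrC /=.
  by congr (_ + _); rewrite /F mulnC exprM on expr1n muln0 expr0 expg_order expg0.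
(* Splitting by [g] keeps the eigenvalues already obtained, as [act h] commutes with the powers of
   [act g] on [fixed K]. *)
have hz j h : h \in s -> exists c : R[i], act h (z j) = c *: z j.
  move=> hs; have hG : h \in G by apply: sG; rewrite inE hs orbT.
  have [c hc] := hy h hs; exists c.
  rewrite (autoZ _ _ (actP hG)) scalerA mulrC -scalerA; congr (_ *: _).
  rewrite (auto_sum _ _ _ (actP hG)) scaler_sumr; apply: eq_bigr => k _.
  rewrite (autoZ _ _ (actP hG)) act_comm_derived // hc (autoZ _ _ (actP (gk k))).
  by rewrite !scalerA mulrC.
rewrite yE; elim/big_ind: _ => // j _; apply: hE => // h.
by rewrite inE => /orP[/eqP->|]; [apply: gz|apply: hz].
Qed.

Lemma normalizer_fixed u : star u * u = 1 -> u * star u = 1 ->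
  (forall x, fixed G x -> fixed G (u * x * star u)) -> fixed K u.
Proof.
move=> uu1 uu2 hu.
have eig g : g \in G -> exists c : R[i], act g u = c *: u.
  move=> gG; have hg := actP gG.
  have [x Nx|c hc] := @relative_commutant_trivial (star u * act g u).
    have gu1 : act g (star u) * act g u = 1 by rewrite -autoM // uu1 auto1.
    have := hu x Nx g gG; rewrite !(autoM hg) Nx // => h.
    rewrite -mulrA -[act g u * x]mulr1 -gu1 !mulrA -(mulrA (star u)) -(mulrA
      (star u)) h.
    by rewrite !mulrA uu1 mul1r.
  by exists c; rewrite -[act g u]mul1r -uu2 -mulrA hc -scalerAr mulr1.
(* The stabilizer of [u] is a subgroup, so commutators suffice; on these the two scalars cancel. *)
pose S := [set g in G | `[< act g u = u >]].
have gS : group_set S.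
  apply/group_setP; split; first by rewrite inE group1 /=; apply/asboolP/act1.
  move=> g h; rewrite !inE => /andP[gG /asboolP gu] /andP[hG /asboolP hu'].
  by rewrite groupM //=; apply/asboolP; rewrite actM // hu'.
move=> k kK; suff /fintype.subsetP/(_ k kK) : K \subset S.
  by rewrite inE => /andP[_ /asboolP].
rewrite -[S]/(gval (Group gS)) gen_subG.
apply/fintype.subsetP => _ /imset2P[g h gG hG ->].
rewrite inE groupR //=; apply/asboolP.
have [c gu] := eig g gG; have [d hu'] := eig h hG.
have hgG : (h * g)%g \in G by rewrite groupM.
apply: (can_inj (actK hgG)); rewrite -actM ?groupR // -commgC.
by rewrite !actM // gu hu' (autoZ _ _ (actP gG)) (autoZ _ _ (actP hG)) gu hu'
  !scalerA mulrC.
Qed.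

End OuterAction.

(** * Unitaries span a monotone closed algebra *)

Section UnitarySpan.
Variables (R : realType) (H : completeNormedModType R[i]).
Variable dot : {dot H for Num.conj}.
Variables (M : set (H -> H)) (hM : star_algebra dot M).
Local Notation A := (opalg hM).
Local Notation "a *r x" := (a%:C%C *: x) (at level 40).
Implicit Types (x y z u : A).

(** A self-adjoint contraction [y] is the mean of the unitaries [y + i z] and [y - i z] with
    [z^2 = 1 - y^2]; taking [z] in the bicentralizer makes it commute with [y]. *)
Lemma unitary_span (B P : set A) : monotone_closed B ->
  (forall c x y, P x -> P y -> P (c *: x + y)) ->
  (forall u, B u -> star u * u = 1 -> u * star u = 1 -> P u) ->
  forall x, B x -> P x.
Proof.
move=> hB Plin Pu; have P1 : P 1 by apply: Pu; rewrite ?star1 ?mulr1 //;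
  exact: mclosed1.
have P0 : P 0 by have := Plin (-1) _ _ P1 P1; rewrite scaleN1r addNr.
have PZ c x : P x -> P (c *: x) by move=> Px; rewrite -[_ *: _]addr0; apply: Plin.
have ii : 'i%C * 'i%C = -1 :> R[i] by rewrite -expr2 sqr_i.
have Psa x : B x -> star x = x -> P x.
  move=> Bx sx; have [k k0 hk] := op_bounded x.
  have k1 : 0 < k + 1 by lra.
  pose y := (k + 1)^-1 *r x; have sy : star y = y by rewrite star_rZ sx.
  have By : B y by apply: mclosedZ.
  have py : pos (1 - y * y).
    split; first by rewrite starB star1 starM sy.
    move=> v; rewrite opaddE opoppE oponeE rdotBl -{1}sy rdot_starM.
    rewrite -(hnorm_sq (star_algebra_form hM)) subr_ge0 ler_pXn2r ?nnegrE
      ?hnorm_ge0 //.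
    rewrite /y opscaleE hnormZ normc_def /= expr0n addr0 sqrtr_sqr ger0_norm;
      last first.
      by rewrite invr_ge0 ltW.
    rewrite mulrC ler_pdivrMr //; apply: le_trans (hk v) _.
    by rewrite mulrC ler_wpM2l ?hnorm_ge0 // lerDl.
  have hB0 := mclosedI hB (mclosed_bicentralizer sy).
  have B0y : (B `&` bicentralizer y) y by split=> //; exact: bicentralizer_id.
  have B0a : ((B `&` bicentralizer y) (1 - y * y)).
    exact (mclosedB hB0 (mclosed1 hB0) (mclosedM hB0 B0y B0y)).
  have [z [[Bz cz] pz zz]] := sqrt_pos hB0 B0a py.
  have yz : z * y = y * z by apply: cz => w ->.
  pose j := 'i%C *: z; pose w := y + j.
  have jy : j * y = y * j by rewrite /j -scalerAl yz scalerAr.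
  have jj : j * j = y * y - 1.
    by rewrite /j -scalerAl -scalerAr scalerA ii zz scaleN1r opprB.
  have sw : star w = y - j by rewrite /w starD sy /j starZ pz.1 conjc_i scaleNr.
  have w1 : star w * w = 1.
    have -> : star w * w = y * y - j * j + (y * j - j * y) by rewrite sw /w; ncring.
    by rewrite jj jy subrr addr0 opprB addrC subrK.
  have w2 : w * star w = 1.
    have -> : w * star w = y * y - j * j + (j * y - y * j) by rewrite sw /w; ncring.
    by rewrite jj jy subrr addr0 opprB addrC subrK.
  have Bw : B w by apply: mclosedD => //; apply: mclosedZ.
  have Bsw : B (star w) by apply: mclosed_star.
  have -> : x = (k + 1) *r ((1 / 2) *r (w + star w)).
    have -> : w + star w = y + y by rewrite sw /w; ncring.
    by rewrite half_add scalerA -rmorphM divff ?gt_eqF // rmorph1 scale1r.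
  apply/PZ/PZ; rewrite -[X in P (X + _)]scale1r.
  by apply: Plin; apply: Pu => //; rewrite starK.
move=> x Bx.
have -> : x = (1 / 2)%:C%C *: (x + star x) + (- 'i%C * (1 / 2)%:C%C) *: ('i%C
  *: (x - star x)).
  rewrite scalerA (_ : - 'i%C * _ * 'i%C = (1 / 2)%:C%C) -?scalerDr; last first.
    by rewrite mulrAC mulNr ii opprK [LHS]mul1r.
  have -> : x + star x + (x - star x) = x + x by ncring.
  by rewrite half_add.
have Bs : B (star x) by apply: mclosed_star.
apply: Plin; last apply: PZ; apply: Psa.
- exact: mclosedD.
- by rewrite starD starK addrC.
- by apply: mclosedZ => //; apply: mclosedB.
- by rewrite starZ starB starK conjc_i scaleNr -scalerN opprB.
Qed.

End UnitarySpan.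

(** * Intertwiners on [H] and the bicommutant of a fixed point algebra *)

Section Bicommutant.
Variables (R : realType) (H : completeNormedModType R[i]).
Variable dot : {dot H for Num.conj}.
Variables (M : set (H -> H)) (hM : star_algebra dot M).
Local Notation A := (opalg hM).
Local Notation rd := (rdot dot).
Local Notation "a *r x" := (a%:C%C *: x) (at level 40).
Implicit Types (x y z u b r d : A) (v w : H).
Variable tr : A -> R.
Hypothesis htr : normal_trace tr.
Hypothesis center_trivial :
  forall x, (forall y, x * y = y * x) -> exists c : R[i], x = c *: 1.

Let hdot := star_algebra_form hM.

(** With [h] inverse to [f], the trace [tr \o h] is also normal and bounds vector functionals at [w]
    from above; [tr] itself is bounded, on a corner, by those at [v]. Applied to [f y * f b * r],
    the first estimate ends in a trace of [b (star y * y) b], where the second takes over. *)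
Lemma dominated_vectors f : star_auto f -> exists v w Q,
  [/\ w != 0, 0 <= Q & forall y, hnorm (f y w) <= Q * hnorm (y v)].
Proof.
move=> hf; have [h fK hK] := auto_bij hf; have hh := auto_inv hf fK hK.
have [b [v [C [b0 sb C0 hC]]]] := trace_bounded_below htr.
have [w [D [w0 D0 hD]]] := trace_bounded_above (normal_trace_auto htr hh).
(* Otherwise [f b] would lie in the ideal annihilating all [r w], and simplicity would give
   [w = 0]. *)
have [r fbr] : exists r, f b (r w) != 0.
  apply/not_existsP => hr; pose J : set A := [set d | forall r, d (r w) = 0].
  have hJ : ideal J.
    split=> [x y hx hy r|c x hx r|x c hx r].
    - by rewrite opaddE hx hy addr0.
    - by rewrite opmulE hx op0.
    - exact: (hx (c * r)).
  have Jfb : J (f b) by move=> r; apply/eqP/negPn/negP/hr.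
  have fb0 : f b <> 0 by move=> fb0; apply: b0; apply: (can_inj fK);
    rewrite fb0 auto0.
  by have := factor_simple htr center_trivial hJ Jfb fb0 1; move/eqP: w0.
have srr : star (h r * star (h r)) = h r * star (h r) by rewrite starM starK.
have [k k0 [hk _]] := sa_le srr.
have k0' := ltW k0.
pose Q := Num.sqrt (D * (k * C)).
exists v, (f b (r w)), Q; split=> [//||y]; first exact: sqrtr_ge0.
rewrite -(ler_pXn2r (ltn0Sn 1)) ?nnegrE ?hnorm_ge0 ?mulr_ge0 ?sqrtr_ge0
  ?hnorm_ge0 //.
rewrite exprMn sqr_sqrtr ?mulr_ge0 // -!opmulE; apply: le_trans (hD _) _.
rewrite -[leRHS]mulrA; apply: ler_wpM2l => //; rewrite -[leRHS]mulrA.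
apply: le_trans (_ : _ <= k * tr (b * (star y * y) * b)) _; last exact: ler_wpM2l.
pose q := y * b;
  have -> : b * (star y * y) * b = star q * q by rewrite starM sb !mulrA.
rewrite (trC htr (star q)) -(trZ htr) /=.
have -> : h (star (f y * f b * r) * (f y * f b * r)) = (star (h r) * star q) *
  (q * h r).
  by rewrite (autoM hh) (auto_star hh) !(autoM hh) !fK -starM.
rewrite [leLHS](trC htr); apply: (pn_le (normal_trace_pn htr)).
have -> : k *r (q * star q) - q * h r * (star (h r) * star q) =
    star (star q) * (k *r 1 - h r * star (h r)) * star q.
  by rewrite starK mulrBr mulrBl -scalerAr mulr1 -scalerAl !mulrA.
exact: pos_conj.
Qed.

(* S w is the Riesz representative, in the closure of M v, of the functional
   y v |-> <f(y) w0, w>. *)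
Lemma intertwining_operator f : star_auto f -> exists S : H -> H,
  [/\ bounded_operator S, forall y v, S (f y v) = y (S v) & exists v, S v <> 0].
Proof.
move=> hf; have [v [w0 [Q [w00 Q0 hQ]]]] := dominated_vectors hf.
pose e y := y v; pose phi w y := rd (f y w0) w.
have eD y z : e (y + z) = e y + e z by [].
have eZ a y : e (a *r y) = a *r e y by [].
have phiD w y z : phi w (y + z) = phi w y + phi w z.
  by rewrite /phi autoD // opaddE rdotDl.
have phiZ w a y : phi w (a *r y) = a * phi w y.
  by rewrite /phi autoZ // opscaleE rdotZl.
have phi_le w y : `|phi w y| <= Q * hnorm w * hnorm (e y).
  apply: le_trans (rdot_abs_le hdot _ _) _.
  by rewrite mulrAC; apply: ler_wpM2r; rewrite ?hnorm_ge0.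
have [S hS] := choice (fun w => riesz hdot eD eZ (phiD w) (phiZ w) (phi_le w)).
have SE w y : rd (S w) (y v) = rd (f y w0) w := (hS w).1 y.
have lS : linear S.
  move=> c w w'; have [_ [x hx]] := hS w; have [_ [x' hx']] := hS w'.
  have [_ [x'' hx'']] := hS (c *: w + w').
  apply: (riesz_unique hdot hx'' (x' := fun n => c *: x n + x' n)).
    by apply: hcvgD hx'; apply: hcvgZ.
  move=> z; rewrite /e rdotDl rdot_conj -opscaleE !SE rdotDr; congr (_ + _).
  by rewrite autoZ // opscaleE rdot_conj conjcK.
exists S; split.
- apply/bounded_operatorP; split=> //; exists Q => // w.
  have [_ [x hx]] := hS w.
  have h : hnorm (S w) ^+ 2 <= Q * hnorm w * hnorm (S w).
    rewrite (hnorm_sq hdot) -subr_ge0.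
    have c1 : Q * hnorm w * hnorm (e (x n)) - rd (e (x n)) (S w) @[n --> \oo] -->
        Q * hnorm w * hnorm (S w) - rd (S w) (S w).
      apply: cvgB; last exact: hcvg_rdot hx.
      by apply: cvgM; [exact: cvg_cst|exact: hcvg_hnorm].
    apply: (cvgr_to_ge c1); apply: nearW => n; rewrite subr_ge0 rdotC SE.
    by apply: le_trans (ler_norm _) (phi_le _ _).
  have [Sw0|Sw0] := eqVneq (hnorm (S w)) 0.
    by rewrite Sw0 mulr_ge0 ?hnorm_ge0.
  by move: h; rewrite expr2 ler_pM2r // lt_neqAle eq_sym Sw0 hnorm_ge0.
- move=> y w; have [_ [x hx]] := hS w; have [_ [x' hx']] := hS (f y w).
  apply: (riesz_unique hdot hx' (x' := fun n => y * x n)).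
    exact: (hcvg_op y hx).
  move=> z; rewrite -[e z]/(z v) SE [RHS]rdot_star -opmulE SE.
  by rewrite (autoM hf) (auto_star hf) opmulE [RHS]rdotC -rdot_star rdotC.
- exists w0 => Sw0; have := SE w0 1; rewrite Sw0 rdot0l auto1 // oponeE.
  by move/esym/(rdot_eq0 hdot)/eqP; apply/negP.
Qed.

(* Automorphisms of M are not assumed to be normal or spatial; S plays the role
   of an implementing unitary. *)
Lemma bicommutant_fixed f x : star_auto f ->
  (forall T : H -> H, bounded_operator T ->
     (forall y, f y = y -> forall v, T (y v) = y (T v)) -> forall v,
       T (x v) = x (T v)) ->
  f x = x.
Proof.
move=> hf hx; have [S [bS SE [v0 Sv0]]] := intertwining_operator hf.
have xS : forall v, S (x v) = x (S v).
  by apply: hx => // y fy v; rewrite -{1}fy SE.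
apply/eqP; rewrite -subr_eq0; apply/eqP; apply: contrapT => d0.
have [lS _] := bS.
have SD v w : S (v + w) = S v + S w by rewrite -[v]scale1r lS !scale1r.
have S0 : S 0 = 0 by apply: (addIr (S 0)); rewrite -SD !add0r.
have SN v : S (- v) = - S v by apply/eqP; rewrite -addr_eq0 -SD addNr S0.
pose J : set A := [set d | forall r v, S (r (d v)) = 0].
have hJ : ideal J.
  split=> [d d' hd hd' r v|c d hd r v|d c hd r v].
  - by rewrite opaddE opD SD hd hd' addr0.
  - by rewrite -[r _]/((r * c) (d v)) hd.
  - by rewrite opmulE hd.
have [h fK hK] := auto_bij hf.
have Jd : J (f x - x).
  by move=> r v; rewrite -(hK r) SE opaddE opoppE SD SN SE xS subrr op0.
have := factor_simple htr center_trivial hJ Jd d0 1 v0.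
by [].
Qed.

End Bicommutant.

(** * From operators on [H] to the algebra [opalg] *)

Section II1Factor.
Variables (R : realType) (H : completeNormedModType R[i]).
Variable dot : {dot H for Num.conj}.
Hypothesis hdot : induces_norm dot.
Variables (M : set (H -> H)).
Implicit Types (f : H -> H) (v w : H).

Lemma commutant_bounded (S : set (H -> H)) : commutant S `<=` bounded_operator
  (H := H).
Proof. by move=> y []. Qed.

Lemma commutant_le (S T : set (H -> H)) : S `<=` T -> commutant T `<=` commutant S.
Proof. by move=> ST y [by_ hy]; split=> // x /ST; apply: hy. Qed.

Lemma star_algebra_bicommutant : von_neumann_algebra dot M -> (idfun : H -> H)
  <> 0 ->
  star_algebra dot M.
Proof.
move=> [hadj MM] id0.
have MP f : M f <-> bounded_operator f /\
    forall y, commutant M y -> forall v, y (f v) = f (y v).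
  rewrite -[X in X f <-> _]MM; split=> -[bf hf]; split=> // y hy.
    by move=> v; have := congr1 (@^~ v) (hf y hy).
  by apply/funext => v; apply: hf.
have Ml y : commutant M y -> linear y by move=> [[]].
split=> //.
- by move=> f /MP[].
- apply/MP; split=> //; apply/bounded_operatorP; split=> //.
  by exists 1 => // v; rewrite mul1r.
- move=> c x y /MP[/bounded_operatorP[lx [a a0 ha]] cx]
  /MP[/bounded_operatorP[ly [b b0 hb]] cy].
  apply/MP; split.
    apply/bounded_operatorP; split=> [k u w|].
      rewrite !fctE lx ly !scalerDr !scalerA addrACA (mulrC c).
      by [].
    have c0 : 0 <= Re `|c| by rewrite -ler0c RRe_real // realE normr_ge0.
    exists (Re `|c| * a + b) => [|v]; first by rewrite addr_ge0 // mulr_ge0.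
    rewrite !fctE; apply: le_trans (hnormD _ _) _; rewrite hnormZ mulrDl -mulrA.
    by apply: lerD => //; apply: ler_wpM2l.
  by move=> z hz v; rewrite !fctE Ml // cx // cy.
- move=> x y /MP[/bounded_operatorP[lx [a a0 ha]] cx] /MP[/bounded_operatorP[ly
  [b b0 hb]] cy].
  apply/MP; split; last by move=> z hz v /=; rewrite cx // cy.
  apply/bounded_operatorP; split=> [k u w|]; first by rewrite /= ly lx.
  exists (a * b) => [|v]; first exact: mulr_ge0.
  by apply: le_trans (ha _) _; rewrite -mulrA; apply: ler_wpM2l.
- move=> x y hx by_ xy; apply/MP; split=> // z hz v.
  have [[lz _] _] := hz.
  have /bounded_operatorP[_ [k _ hk]] := commutant_bounded hz.
  apply: hcvg_unique (hcvg_bounded lz hk (xy v)) _.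
  have := xy (z v); congr hcvg; apply/funext => n /=.
  by have /MP[_ ->] := hx n.
Qed.

Variable tau : (H -> H) -> R[i].
Hypothesis htau : faithful_normal_tracial_state dot M tau.
Variable hM : star_algebra dot M.
Local Notation A := (opalg hM).

Definition real_trace (x : A) : R := Re (tau x).

Lemma tau_pos (x : A) : pos x -> 0 <= tau x.
Proof.
have [_ hpos _ _ _] := htau => px.
have [y [_ py <-]] := sqrt_pos (mclosedT hM) (I : setT x) px.
have := hpos _ _ (opvalP y) (starP y); rewrite py.1.
by [].
Qed.

Lemma operator_leP (x y : A) : star x = x -> star y = y ->
  operator_le dot x y <-> pos (y - x).
Proof.
move=> sx sy; have syx : star (y - x) = y - x by rewrite starB sx sy.
have E v : (opval y - opval x) v = (y - x) v by rewrite opaddE opoppE.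
split=> [h|[_ h]]; first split=> // v.
  by have := h v; rewrite E dot_sa // ler0c.
by move=> v; rewrite E dot_sa // ler0c.
Qed.

Lemma real_trace_normal : normal_trace real_trace.
Proof.
have [tlin tpos tid tC [tfaith tnorm]] := htau.
have t0 : tau (0 : A) = 0.
  have := tlin (-1) _ _ (star_algebra_id hM) (star_algebra_id hM).
  by rewrite scaleN1r addNr mulN1r addNr.
split.
- move=> x y; rewrite /real_trace -[in LHS](scale1r x).
  by rewrite -[tau _]/(tau (1 *: (x : H -> H) + y)) tlin ?mul1r ?raddfD //;
    apply: opvalP.
- move=> k x; rewrite /real_trace -[in LHS](addr0 (_ *: x)).
  rewrite -[tau _]/(tau (k%:C%C *: (x : H -> H) + (0 : A))) tlin ?t0 ?addr0;
    try exact: opvalP.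
  by case: (tau x) => a b /=; rewrite mul0r subr0.
- move=> x y; rewrite /real_trace -[tau (x * y)]/(tau (x \o y)) tC //; exact: opvalP.
- by rewrite /real_trace -[tau _]/(tau idfun) tid.
- by move=> x /tau_pos; rewrite lecE => /andP[].
- move=> x px rx; have tx : tau x = 0.
    have := tau_pos px; move: rx; rewrite /real_trace lecE.
    by case: (tau x) => a b /= -> /andP[/eqP -> _].
  have [y [_ py yx]] := sqrt_pos (mclosedT hM) (I : setT x) px.
  have y0 : opval y = 0.
    apply: (tfaith _ _ (opvalP y) (starP y)).
    by rewrite py.1 -[RHS]tx -yx.
  by rewrite -yx [y](_ : _ = 0) ?mulr0 //; apply: op_inj; rewrite y0.
(* The range of the sequence is directed, and its strong limit is its least upper bound among the
   self-adjoint elements of [M]. *)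
- move=> x l t mx xl hx.
  pose D := [set opval (x n) | n in setT].
  have sl := (scvg_unit_itv mx xl).1.1.
  have sx n : star (x n) = x n by case: (mx.1 n) => -[].
  have DM : D `<=` self_adjoint_part dot M.
    by move=> _ [n _ <-]; split; [exact: opvalP|rewrite -{2}sx; apply: starP].
  have Ddir : directed_set (operator_le dot) D.
    split; first by exists (opval (x 0%N)), 0%N.
    move=> _ _ [m _ <-] [n _ <-]; exists (opval (x (maxn m n))); split.
    - by exists (maxn m n).
    - by apply/operator_leP => //; apply: monotone_unit_le mx _; apply: leq_maxl.
    - by apply/operator_leP => //; apply: monotone_unit_le mx _; apply: leq_maxr.
  have lub : least_upper_bound (operator_le dot) (self_adjoint_part dot M) D l.
    split.
    - by split; [exact: opvalP|rewrite -{2}sl; apply: starP].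
    - by move=> _ [n _ <-]; apply/operator_leP => //; apply: scvg_ge mx xl.
    - move=> b [Mb sb] hb; pose b' : A := OpAlg hM Mb.
      have sb' : star b' = b' by apply: star_adjoint.
      apply/(operator_leP (y := b')) => //; apply: scvg_le xl => n.
      by apply/(operator_leP (y := b')) => //; apply: hb; exists n.
  have [_ _ /(_ t%:C%C I)] := tnorm D l DM Ddir lub.
  have h : forall d, (tau @` D) d -> d <= t%:C%C.
    move=> _ [_ [n _ <-] <-]; have := tau_pos (mx.1 n).1; have := hx n.
    rewrite /real_trace !lecE /= => -> /andP[/eqP ->].
    by rewrite eqxx.
  by move=> /(_ h); rewrite lecE => /andP[].
Qed.

Variables (gT : finGroupType) (G : {group gT}) (alpha : gT -> (H -> H) -> (H -> H)).
Hypothesis halpha : outer_action dot M G alpha.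

(* The value x is junk: alpha g preserves M for g in G. *)
Definition opact (g : gT) (x : A) : A :=
  if pselect (M (alpha g x)) is left Mgx then OpAlg hM Mgx else x.

Lemma opactE g (x : A) : g \in G -> opval (opact g x) = alpha g x.
Proof.
have [hauto _ _] := halpha => gG; rewrite /opact; case: pselect => // -[].
by have [[hfun _ _] _ _ _] := hauto g gG; apply: hfun; apply: opvalP.
Qed.

Lemma opactM g h : g \in G -> h \in G ->
  forall x, opact (g * h)%g x = opact g (opact h x).
Proof.
have [_ hmul _] := halpha => gG hG x; apply: op_inj.
by rewrite !opactE ?groupM // hmul //; apply: opvalP.
Qed.

Lemma opact_inj g : g \in G -> injective (opact g).
Proof.
have [hauto _ _] := halpha => gG x y /(congr1 (@opval _ _ _ _ _)).
rewrite !opactE //; have [[_ hinj _] _ _ _] := hauto g gG => e.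
by apply: op_inj; apply: hinj e; rewrite inE; apply: opvalP.
Qed.

Lemma opact1 x : opact 1%g x = x.
Proof.
apply: (opact_inj (group1 G)).
by rewrite -opactM ?group1 // mulg1.
Qed.

Lemma opact_auto g : g \in G -> star_auto (opact g).
Proof.
have [hauto _ _] := halpha => gG.
have [_ hlin hmul hadj] := hauto g gG.
split.
- by move=> c x y; apply: op_inj; rewrite opactE //= !opactE // -hlin //;
  apply: opvalP.
- by move=> x y; apply: op_inj; rewrite opactE //= !opactE // -hmul //;
  apply: opvalP.
- move=> x; apply/esym/star_adjoint; rewrite !opactE //.
  by apply: hadj; [exact: opvalP|exact: opvalP|exact: starP].
- exists (opact g^-1%g) => x; rewrite -opactM ?groupV //.
    by rewrite mulVg opact1.
  by rewrite mulgV opact1.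
Qed.

Lemma star_unitary (u : A) : star u * u = 1 -> u * star u = 1 ->
  unitary_with_adjoint dot u (star u).
Proof.
move=> uu1 uu2; split; first exact: starP.
  exact: (congr1 (@opval _ _ _ _ _) uu2).
exact: (congr1 (@opval _ _ _ _ _) uu1).
Qed.

Lemma opact_outer g : g \in G -> g != 1%g -> forall u : A,
  star u * u = 1 -> u * star u = 1 -> ~ (forall x, opact g x = u * x * star u).
Proof.
have [_ _ hout] := halpha => gG g1 u uu1 uu2 hu; apply: (hout g gG g1).
exists u, (star u); split; [exact: opvalP|exact: star_unitary|].
move=> x Mx; have := congr1 (@opval _ _ _ _ _) (hu (OpAlg hM Mx)).
by rewrite opactE.
Qed.

Lemma fixed_pointsE (S : {set gT}) (x : A) : S \subset G ->
  fixed_points M alpha S x <-> fixed opact S x.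
Proof.
move=> /fintype.subsetP SG; split=> [[_ hx] g gS|hx].
  by apply: op_inj; rewrite opactE ?SG // hx.
split; first exact: opvalP.
by move=> g gS; rewrite -{2}(hx g gS) opactE // SG.
Qed.

End II1Factor.

(** * The von Neumann algebra generated by the normalizers *)

Theorem theorem5p4 (R : realType) (H : completeNormedModType R[i])
    (dot : {dot H for Num.conj}) (hdot : induces_norm dot)
    (hsep : separable_space H)
    (M : set (H -> H)) (hM : II1_factor dot M)
    (gT : finGroupType) (G : {group gT})
    (alpha : gT -> (H -> H) -> (H -> H))
    (halpha : outer_action dot M G alpha) :
  commutant (commutant (unitary_normalizer dot M (fixed_points M alpha G))) =
  fixed_points M alpha [~: G, G]%g.
Proof.
have [[hvN hfac] _ [tau htau]] := hM.
(* The zero space is excluded because a tracial state takes the value 1 at [idfun]. *)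
have id0 : (idfun : H -> H) <> 0.
  move=> id0; have [tlin _ tid _ _] := htau.
  have Mid : M idfun.
    rewrite -hvN.2; split=> //; apply/bounded_operatorP; split=> //.
    by exists 1 => // v; rewrite mul1r.
  have := tlin (-1) _ _ Mid Mid; rewrite scaleN1r addNr -id0 tid mulr1 addNr.
  by move/eqP; rewrite oner_eq0.
have hA := star_algebra_bicommutant hdot hvN id0.
have htr := real_trace_normal htau hA.
have center (x : opalg hA) : (forall y, x * y = y * x) -> exists c : R[i],
  x = c *: 1.
  move=> hx; have : (M `&` commutant M) x.
    split; first exact: opvalP.
    split; first exact: (star_algebra_bounded hA (opvalP x)).
    move=> y My; exact: (congr1 (@opval _ _ _ _ _) (esym (hx (OpAlg hA My)))).
  by rewrite hfac => -[c xc]; exists c; apply: op_inj.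
pose act := opact (hM := hA) alpha.
have actP : forall g, g \in G -> star_auto (act g) := opact_auto hA halpha.
have actM : forall g h, g \in G -> h \in G ->
  forall x, act (g * h)%g x = act g (act h x) := opactM halpha.
have act_out := opact_outer (hM := hA) halpha.
have fixG (x : opalg hA) := fixed_pointsE halpha x (fintype.subxx G).
have fixK (x : opalg hA) := fixed_pointsE halpha x (der1_subG G).
set N := fixed_points M alpha G in fixG *; set S := unitary_normalizer _ _ _.
have SK u : S u -> exists2 u' : opalg hA, u = u' & fixed act [~: G, G]%g u'.
  move=> [Mu [v [[uv uv1 vu1] uN]]]; pose u' : opalg hA := OpAlg hA Mu.
  have vE : v = star u' by apply: adjoint_star.
  exists u' => //; apply: (normalizer_fixed htr center actP actM act_out).
  - by apply: op_inj; rewrite -[opval 1]vu1 vE.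
  - by apply: op_inj; rewrite -[opval 1]uv1 vE.
  - move=> x /fixG Nx; apply/fixG; rewrite -uN; exists (opval x) => //.
    by rewrite vE.
apply/seteqP; split=> [x SSx|x Kx].
  have Mx : M x.
    rewrite -hvN.2; apply: commutant_le SSx; apply: commutant_le.
    by move=> u [].
  pose x' : opalg hA := OpAlg hA Mx.
  apply/(fixK x') => k kK.
  apply: (bicommutant_fixed htr center);
    first exact/actP/(fintype.subsetP (der1_subG G)).
  (* Normalizers are fixed by [K], hence by [act k], so [T] commutes with all of them and therefore
     with [x]. *)
  move=> T bT hT v; have ST : commutant S T.
    split=> // u /SK[u' -> uK]; apply/funext => w /=.
    by rewrite hT //; apply: uK.
  have [_ /(_ T ST)] := SSx; exact: (congr1 (@^~ v)).
have Mx : M x by case: Kx.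
pose x' : opalg hA := OpAlg hA Mx.
split; first exact: (star_algebra_bounded hA Mx).
move=> T [[lT _] hT]; apply/funext => v0; rewrite /=; move: v0.
have TD v w : T (v + w) = T v + T w by rewrite -[v]scale1r lT !scale1r.
have T0 : T 0 = 0 by apply: (addIr (T 0)); rewrite -TD !add0r.
have TZ c v : T (c *: v) = c *: T v by rewrite -[c *: v]addr0 lT T0 addr0.
pose P := [set y : opalg hA | forall v, T (y v) = y (T v)].
suff : P x' by [].
apply: (eigenvector_ind actP actM _ _ _ (G := G)); last exact/fixK.
- by move=> v; rewrite !opE T0.
- by move=> y z Py Pz v; rewrite !opE TD Py Pz.
move=> y Ky eig; have [->|/eqP y0] := eqVneq y 0; first by move=> v; rewrite !opE T0.
(* Off [G] the value 0 is arbitrary; it makes [chi] a total function. *)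
have eigG g : exists c, g \in G -> act g y = c *: y.
  have [gG|] := boolP (g \in G); last by exists 0.
  by have [c hc] := eig g gG; exists c.
have [chi hchi] := choice eigG.
have chiM g h : g \in G -> h \in G -> chi (g * h)%g = chi g * chi h.
  move=> gG hG; apply: (scalar_op_inj y0).
  rewrite -hchi ?groupM // actM // hchi // (autoZ _ _ (actP _ gG)) hchi //.
  by rewrite scalerA mulrC.
have chi1 : chi 1%g = 1.
  by apply: (scalar_op_inj y0); rewrite -hchi // scale1r; exact: opact1 halpha y.
have chi_unit g : g \in G -> (chi g)^*%C * chi g = 1.
  move=> gG; have chiX n : chi (g ^+ n)%g = chi g ^+ n.
    by elim: n => [|n IH]; rewrite ?expg0 ?chi1 // expgS exprS chiM ?groupX // IH.
  have n1 : `|chi g| ^+ #[g]%g = 1 by rewrite -normrX -chiX expg_order chi1 normr1.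
  have /eqP c1 : `|chi g| == 1 by rewrite -(@pexpr_eq1 _ _ #[g]%g) ?n1 ?order_gt0.
  by rewrite mulrC -sqr_normc c1 expr1n.
have [u [Xu uu1 uu2]] :=
  eigenspace_unitary htr center actP actM act_out chiM chi_unit.
(* A unitary eigenvector normalizes [N]: the unimodular scalars cancel in [w z (star w)].
   Conjugation by [star w] gives the reverse inclusion. *)
have NS (w : opalg hA) : star w * w = 1 -> w * star w = 1 ->
    (forall g, g \in G -> exists2 c, act g w = c *: w & c^*%C * c = 1) -> S w.
  move=> ww1 ww2 hw; split; first exact: opvalP.
  exists (star w); split; first exact: star_unitary.
  have conjl z : fixed act G z -> fixed act G (w * z * star w).
    move=> Nz g gG; have [c hc cc] := hw g gG.
    rewrite !(autoM (actP g gG)) (auto_star (actP g gG)) hc Nz // starZ.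
    by rewrite -scalerAr -!scalerAl scalerA cc scale1r.
  have conjr z : fixed act G z -> fixed act G (star w * z * w).
    move=> Nz g gG; have [c hc cc] := hw g gG.
    rewrite !(autoM (actP g gG)) (auto_star (actP g gG)) hc Nz // starZ.
    by rewrite -scalerAr -!scalerAl scalerA mulrC cc scale1r.
  apply/seteqP; split=> [_ [z Nz <-]|z Nz]; have [Mz _] := Nz;
    pose z' : opalg hA := OpAlg hA Mz.
    by apply/(fixG (w * z' * star w))/conjl/(fixG z').
  exists (opval (star w * z' * w)); first by apply/fixG/conjr/(fixG z').
  have : w * (star w * z' * w) * star w = z'
    by rewrite !mulrA ww2 mul1r -mulrA ww2 mulr1.
  exact: (congr1 (@opval _ _ _ _ _)).
have PS (w : opalg hA) : S w -> P w by move=> /hT wT v; have := congr1 (@^~ v) wT.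
have Pu : P u by apply/PS/NS => // g gG; exists (chi g); [exact: Xu|exact: chi_unit].
(* Since [u] and [y] share the character [chi], [star u * y] lies in [N], which is spanned by its
   unitaries; these are normalizers with eigenvalue 1. *)
have Nn : fixed act G (star u * y).
  move=> g gG; rewrite (autoM (actP g gG)) (auto_star (actP g gG)) Xu // hchi //.
  by rewrite starZ -scalerAr -scalerAl scalerA mulrC chi_unit // scale1r.
have Pn : P (star u * y).
  apply: (unitary_span (mclosed_fixed actP (fintype.subxx G))) Nn.
    by move=> c z z' Pz Pz' v; rewrite !opE TD TZ Pz Pz'.
  move=> w Nw ww1 ww2; apply/PS/NS => // g gG.
  by exists 1; rewrite ?scale1r ?Nw // conjc1 mulr1.
move=> v; have -> : y = u * (star u * y) by rewrite mulrA uu2 mul1r.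
by rewrite opmulE Pu Pn.
Qed.
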